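(* There exists a choice of numerical constants $\hat K,\tilde K$ such that the following holds for any sequence $\{t_k\}$ of positive numbers. Suppose $\hat\delta_n(\mathcal{F}_k;t_k)$ (data-dependent) and $\tilde\delta_n(\mathcal{F}_k;t_k)$ (distribution-dependent), $k\ge1$, satisfy $$\mathbb{P}\{\bar\delta_n(\mathcal{F}_k;t_k)\le\hat\delta_n(\mathcal{F}_k;t_k)\le\tilde\delta_n(\mathcal{F}_k;t_k)\}\ge1-p_k\quad\text{for all }k.$$ Define $$\hat\pi(k):=\hat K\left[\hat\delta_n(\mathcal{F}_k;t_k)+\sqrt{\frac{t_k}n\inf_{\mathcal{F}_k}P_nf}+\frac{t_k}n\right],\qquad\tilde\pi(k):=\tilde K\left[\tilde\delta_n(\mathcal{F}_k;t_k)+\sqrt{\frac{t_k}n\inf_{\mathcal{F}_k}Pf}+\frac{t_k}n\right],$$ $\hat k:=\operatorname{argmin}_{k\ge1}\{P_n\hat f_{n,k}+\hat\pi(k)\}$ and $\hat f:=\hat f_{n,\hat k}$. Then $$\mathbb{P}\Big\{P\hat f\ge\inf_{k\ge1}\{P_n\hat f_{n,k}+\hat\pi(k)\}\Big\}\le\sum_{k=1}^\infty\Big(p_k+\log_q\frac{q^3n}{t_k}e^{-t_k}\Big)$$ and $$\mathbb{P}\Big\{\mathcal{E}_P(\mathcal{F};\hat f)\ge\inf_{k\ge1}\Big\{\inf_{f\in\mathcal{F}_k}Pf-\inf_{f\in\mathcal{F}}Pf+\tilde\pi(k)\Big\}\Big\}\le\sum_{k=1}^\infty\Big(p_k+\l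og_q\frac{q^3n}{t_k}e^{-t_k}\Big).$$
   Context: $(S,\mathcal{A},P)$ is a probability space, $\mathcal{F}$ is a class of measurable functions $f:S\to[0,1]$, $\mathcal{F}_k\subset\mathcal{F}$, $k\ge1$, are subclasses, $X_1,\dots,X_n$ are i.i.d. with distribution $P$, $P_n$ is the empirical measure. $\mathcal{E}_P(\mathcal{F};f):=Pf-\inf_{g\in\mathcal{F}}Pg$. $\hat f_{n,k}$ is a minimizer of $P_nf$ over $\mathcal{F}_k$ (assumed to exist). $q>1$ is fixed, $\delta_j:=q^{-j}$, $j\in\mathbb{Z}$; for $\psi:\mathbb{R}_+\to\mathbb{R}_+$, $\psi^{\flat,q}(\delta):=\sup_{j:\,\delta_j\ge\delta}\psi(\delta_j)/\delta_j$ and $\psi^{\sharp,q}(\varepsilon):=\inf\{\delta>0:\psi^{\flat,q}(\delta)\le\varepsilon\}$. $\rho_P:L_2(P)\times L_2(P)\to[0,\infty)$ is a fixed function with $\rho_P^2(f,g)\ge P(f-g)^2-(P(f-g))^2$ (e.g. $\rho_P^2(f,g)=P(f-g)^2$). For $\mathcal{G}\subset\mathcal{F}$: $\mathcal{G}(\delta):=\{f\in\mathcal{G}:Pf-\inf_{g\in\mathcal{G}}Pg\le\delta\}$, $D_P(\mathcal{G};\delta):=\sup_{f,g\in\mathcal{G}(\delta)}\rho_P(f,g)$, $\phi_n(\mathcal{G};\delta):=\mathbb{E}\sup_{f,g\in\mathcal{G}(\delta)}|(P_n-P)(f-g)|$, $\bar U_{n,t}(\delta):=2\big(\phi_n(\mathcal{G};\delta)+D_P(\mathcal{G};\delta)\sqrt{t/n}+t/n\big)$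 and $\bar\delta_n(\mathcal{G};t):=\bar U_{n,t}^{\sharp,q}(\frac1{2q^3})$.
   Formalization: The logarithm in log_q(q^3 n/t_k)e^{-t_k} is replaced by its positive part (the printed bound can be negative when t_k > q^3 n), and weighted sample suprema over centred differences of F_k(δ) are assumed measurable, so that E sup is well defined. *)

(* Defs.v *)
From HB Require Import structures.
From mathcomp Require Import all_boot all_order all_algebra.
From mathcomp Require Import all_classical all_reals all_analysis.
From mathcomp Require Import measurable_realfun.

Set Implicit Arguments.
Unset Strict Implicit.
Unset Printing Implicit Defensive.
Import Order.TTheory GRing.Theory Num.Theory.
Import numFieldNormedType.Exports.

Local Open Scope classical_set_scope.
Local Open Scope ring_scope.

Section discretized_transforms.
Context {R : realType}.
Implicit Types (q : R) (psi : R -> \bar R).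

Definition level q (j : int) : R := q ^ (- j).

(* The transforms are extended-real valued: the diameter D_P below may be
   infinite, and the infimum defining psi^sharp may range over the empty set. *)
Definition flat q psi (dlt : R) : \bar R :=
  ereal_sup [set (psi (level q j) * ((level q j)^-1)%:E)%E
            | j in [set j : int | dlt <= level q j]].

Definition sharp q psi (eps : R) : \bar R :=
  ereal_inf [set dlt%:E
            | dlt in [set dlt : R | 0 < dlt /\ (flat q psi dlt <= eps%:E)%E]].

Definition logb q (x : R) : R := ln x / ln q.

(* The summand  p + log_q (q^3 n / t) e^{-t}.  The logarithm is negative as
   soon as t > q^3 n, where its product with e^{-t} cannot serve as a bound on
   a probability; the term is then read as 0, i.e. the positive part of the
   logarithm is taken. *)
Definition failure_term q (n : nat) (p t : R) : R :=
  p + Num.max 0 (logb q (q ^+ 3 * n%:R / t)) * expR (- t).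

Definition penalty (K : R) (n : nat) (t dlt risk : R) : R :=
  K * (dlt + Num.sqrt (t / n%:R * risk) + t / n%:R).

End discretized_transforms.

Section population.
Context {R : realType} {d : measure_display} {S : measurableType d}.
Variable P : probability S R.
Implicit Types (f g : S -> R) (G : set (S -> R)) (rho : (S -> R) -> (S -> R) -> R).

Definition mean f : R := (\int[P]_x f x)%R.

Definition min_risk G : R := inf [set mean g | g in G].

Definition excess_risk G f : R := mean f - min_risk G.

Definition slice G (dlt : R) : set (S -> R) :=
  [set f | G f /\ excess_risk G f <= dlt].

(* rho is only constrained on L_2(P); its values elsewhere are irrelevant. *)
Definition dominates_variance rho : Prop :=
  forall f g, f \in Lfun P 2%:E -> g \in Lfun P 2%:E ->
    0 <= rho f g /\
    mean (fun x => (f x - g x) ^+ 2) - (mean (fun x => f x - g x)) ^+ 2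
      <= rho f g ^+ 2.

Definition diam rho G (dlt : R) : \bar R :=
  ereal_sup [set (rho fg.1 fg.2)%:E | fg in slice G dlt `*` slice G dlt].

Definition centred_differences G : set (S -> R) :=
  [set (fun x => fg.1 x - fg.2 x - mean (fun y => fg.1 y - fg.2 y))
  | fg in G `*` G].

(* The usual notion of a "P-measurable class" (van der Vaart and Wellner) for
   samples of size n.  It makes the suprema of the empirical process, and of
   its leave-some-out versions, random variables. *)
Definition measurable_class (n : nat) G : Prop :=
  forall e : 'I_n -> R,
    measurable_fun [set: n.-tuple S]
      (fun x : n.-tuple S =>
         ereal_sup [set `|\sum_(i < n) e i * h (tnth x i)|%:E | h in G]).

End population.

Section sample.
Context {R : realType} {d d' : measure_display}
  {S : measurableType d} {Omega : measurableType d'}.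
Variables (P : probability S R) (Pr : probability Omega R) (n : nat).
Variable X : 'I_n -> {RV Pr >-> S}.
Implicit Types (f : S -> R) (G : set (S -> R)) (w : Omega).

(* Independence: as some of the A i may be taken to be the whole space, the
   product rule over all of 'I_n contains the one over each subfamily. *)
Definition iid_sample : Prop :=
  (forall i (A : set S), measurable A -> distribution Pr (X i) A = P A) /\
  (forall A : 'I_n -> set S, (forall i, measurable (A i)) ->
     Pr (\bigcap_(i in [set: 'I_n]) X i @^-1` A i) =
     (\prod_(i < n) fine (Pr (X i @^-1` A i)))%:E).

Definition emp f w : R := n%:R^-1 * \sum_(i < n) f (X i w).

Definition phi G (dlt : R) : \bar R :=
  (\int[Pr]_w
     ereal_sup [set `|emp (fun x => fg.1 x - fg.2 x) w
                      - mean P (fun x => fg.1 x - fg.2 x)|%:E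
               | fg in slice P G dlt `*` slice P G dlt])%E.

Definition Ubar (rho : (S -> R) -> (S -> R) -> R) G (t dlt : R) : \bar R :=
  (2%:E * (phi G dlt + diam P rho G dlt * (Num.sqrt (t / n%:R))%:E
           + (t / n%:R)%:E))%E.

Definition delta_bar (q : R) (rho : (S -> R) -> (S -> R) -> R) G (t : R)
    : \bar R :=
  sharp q (Ubar rho G t) (2 * q ^+ 3)^-1.

Definition min_emp_risk G w : R := inf [set emp f w | f in G].

End sample.

(* Main.v *)
Require Import Defs.
From HB Require Import structures.
From mathcomp Require Import all_boot all_order all_algebra.
From mathcomp Require Import all_classical all_reals all_analysis.
From mathcomp Require Import measurable_realfun.
From mathcomp Require Import ring lra.
Import Order.TTheory GRing.Theory Num.Theory.
Import numFieldNormedType.Exports.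
Set Implicit Arguments.
Unset Strict Implicit.
Unset Printing Implicit Defensive.
Local Open Scope classical_set_scope.
Local Open Scope ring_scope.

(* Fix k and write a = t_k / n and G = F_k.  The analytic input is a weak form of
   Bousquet's version of Talagrand's inequality: with probability at least
   1 - e^{-t},
     sup |(P_n - P)(f - g)| <= 2 phi_n + (3/2) D sqrt(t/n) + 4 t/n <= 2 Ubar
   over a slice of G.  It comes from the entropy method.  If Z is the supremum of
   the sums, Z_i its leave-one-out version and Y_i the increment of a
   near-maximizer of Z_i, then Y_i <= Z - Z_i <= 1 (after rescaling), Y_i is
   centred given the other observations and sum_i (Z - Z_i) <= Z.  Tensorization
   of entropy and a pointwise bound of the entropy gap by
     l^2 ((Z - Z_i) e^{l (Z - Z_i)} - Y_i) + l^2 Y_i^2 / 2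
   give l (1 - l) L' - L <= l^2 n sigma^2 / 2 for the log-Laplace transform L of
   Z, hence L(l) <= (l E Z + l^2 n sigma^2 / 2) / (1 - l).

   At every level delta_j in ]delta_bar, 1] the definition of delta_bar turns this
   into a deviation of at most delta_j / q^3, so that the empirical minimizer
   descends from one slice to the next until its excess risk is at most
   delta_bar.  Bernstein's inequality for one fixed near-minimizer of the risk
   then compares P fhat, P_n fhat and inf_G P up to the penalties.  Since
   delta_bar >= 4 q^3 a, the number of levels plus the two tails of Bernstein's
   inequality is at most log_q (q^3 n / t), and a union bound over k concludes. *)

(** * Expectation of bounded measurable functions *)

Section bounded_measurable.
Context {R : realType} {d : measure_display} {T : measurableType d}.
Implicit Types f g : T -> R.

(** The random variables of the concentration argument are all bounded, so this one predicate, with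
    its closure properties, settles integrability and the conditions of Fubini's theorem. *)
Definition bounded_measurable f :=
  measurable_fun [set: T] f /\ exists M : R, forall x, `|f x| <= M.

Lemma bm_cst (c : R) : bounded_measurable (fun=> c).
Proof. by split; [exact: measurable_cst | exists `|c|]. Qed.

Lemma bmD f g : bounded_measurable f -> bounded_measurable g ->
  bounded_measurable (fun x => f x + g x).
Proof.
move=> [mf [M fM]] [mg [N gN]]; split; first exact: measurable_funD.
by exists (M + N) => x; rewrite (le_trans (ler_normD _ _))// lerD.
Qed.

Lemma bmM f g : bounded_measurable f -> bounded_measurable g ->
  bounded_measurable (fun x => f x * g x).
Proof.
move=> [mf [M fM]] [mg [N gN]]; split; first exact: measurable_funM.
by exists (M * N) => x; rewrite normrM ler_pM.
Qed.

Lemma bmZ (c : R) f : bounded_measurable f ->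
  bounded_measurable (fun x => c * f x).
Proof. by move=> bf; apply: bmM => //; exact: bm_cst. Qed.

Lemma bmN f : bounded_measurable f -> bounded_measurable (fun x => - f x).
Proof.
move=> bf; have := bmZ (-1) bf; congr bounded_measurable.
by apply/funext => x; rewrite mulN1r.
Qed.

Lemma bmB f g : bounded_measurable f -> bounded_measurable g ->
  bounded_measurable (fun x => f x - g x).
Proof. by move=> bf bg; apply: bmD => //; exact: bmN. Qed.

Lemma bm_sum (I : Type) (s : seq I) (F : I -> T -> R) :
  (forall i, bounded_measurable (F i)) ->
  bounded_measurable (fun x => \sum_(i <- s) F i x).
Proof.
move=> bF; elim: s => [|i s IH].
  by under eq_fun do rewrite big_nil; exact: bm_cst.
by under eq_fun do rewrite big_cons; exact: bmD.
Qed.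

Lemma bm_exp f : bounded_measurable f ->
  bounded_measurable (fun x => expR (f x)).
Proof.
move=> [mf [M fM]]; split; first exact: measurableT_comp.
exists (expR M) => x; rewrite ger0_norm ?expR_ge0// ler_expR.
exact: le_trans (ler_norm _) (fM x).
Qed.

Lemma bm_ln f c : 0 < c -> (forall x, c <= f x) -> bounded_measurable f ->
  bounded_measurable (fun x => ln (f x)).
Proof.
move=> c0 cf [mf [M fM]]; split; first exact: measurableT_comp.
exists (`|ln c| + `|ln M|) => x.
have fx0 : 0 < f x by exact: lt_le_trans (cf x).
have M0 : f x <= M by rewrite (le_trans (ler_norm _)).
rewrite ler_norml; apply/andP; split.
  rewrite lerNl; apply: (@le_trans _ _ (- ln c)).
    by rewrite lerN2 ler_ln ?posrE.
  by rewrite (le_trans (ler_norm _))// normrN lerDl.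
apply: (@le_trans _ _ (ln M)).
  by rewrite ler_ln ?posrE// (lt_le_trans fx0).
by rewrite (le_trans (ler_norm _))// lerDr.
Qed.

Variable P : probability T R.

Lemma bm_integrable f : bounded_measurable f ->
  P.-integrable [set: T] (EFin \o f).
Proof.
move=> [mf [M fM]]; apply: (@le_integrable _ _ _ _ _ _ _ (EFin \o cst M)) => //.
- exact/measurable_EFinP.
- move=> x _ /=; rewrite lee_fin (le_trans (fM x))// ler_norm//.
- exact: finite_measure_integrable_cst.
Qed.

Lemma mean_cst (c : R) : mean P (fun=> c) = c.
Proof. by rewrite /mean Rintegral_cst//= probability_setT mulr1. Qed.

Lemma meanD f g : bounded_measurable f -> bounded_measurable g ->
  mean P (fun x => f x + g x) = mean P f + mean P g.
Proof. by move=> *; apply: RintegralD => //; exact: bm_integrable. Qed.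

Lemma meanB f g : bounded_measurable f -> bounded_measurable g ->
  mean P (fun x => f x - g x) = mean P f - mean P g.
Proof. by move=> *; apply: RintegralB => //; exact: bm_integrable. Qed.

Lemma meanZ (c : R) f : bounded_measurable f ->
  mean P (fun x => c * f x) = c * mean P f.
Proof. by move=> *; apply: RintegralZl => //; exact: bm_integrable. Qed.

Lemma mean_sum (I : Type) (s : seq I) (F : I -> T -> R) :
  (forall i, bounded_measurable (F i)) ->
  mean P (fun x => \sum_(i <- s) F i x) = \sum_(i <- s) mean P (F i).
Proof.
move=> bF; elim: s => [|i s IH].
  by under eq_fun do rewrite big_nil; rewrite mean_cst big_nil.
under eq_fun do rewrite big_cons.
by rewrite meanD// ?IH ?big_cons//; exact: bm_sum.
Qed.

Lemma le_mean f g : bounded_measurable f -> bounded_measurable g ->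
  (forall x, f x <= g x) -> mean P f <= mean P g.
Proof. by move=> bf bg fg; apply: le_Rintegral => //; exact: bm_integrable. Qed.

Lemma mean_ge0 f : (forall x, 0 <= f x) -> 0 <= mean P f.
Proof. by move=> f0; apply: Rintegral_ge0. Qed.

Lemma norm_mean_le f (M : R) : bounded_measurable f ->
  (forall x, `|f x| <= M) -> `|mean P f| <= M.
Proof.
move=> bf fM; rewrite ler_norml; apply/andP; split.
  rewrite -[leLHS]mean_cst; apply: le_mean => // [|x]; first exact: bm_cst.
  by have := fM x; rewrite ler_norml => /andP[].
rewrite -[leRHS]mean_cst; apply: le_mean => // [|x]; first exact: bm_cst.
exact: le_trans (ler_norm _) (fM x).
Qed.

End bounded_measurable.


Lemma bm_comp {R : realType} d d' (T : measurableType d) (T' : measurableType d')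
    (h : T' -> T) (f : T -> R) :
  measurable_fun [set: T'] h -> bounded_measurable f ->
  bounded_measurable (fun x => f (h x)).
Proof.
move=> mh [mf [M fM]]; split; first exact: measurableT_comp.
by exists M => x; exact: fM.
Qed.

(** * Fubini's theorem for bounded functions *)

Section product.
Context {R : realType} {d d' : measure_display} {T : measurableType d}
  {T' : measurableType d'} (P : probability T R) (Q : probability T' R).
Variable f : T * T' -> R.
Hypothesis bf : bounded_measurable f.

Lemma bm_pair1 x : bounded_measurable (fun y => f (x, y)).
Proof. by apply: (bm_comp _ bf); exact: measurable_pair1. Qed.

Lemma bm_pair2 y : bounded_measurable (fun x => f (x, y)).
Proof. by apply: (bm_comp _ bf); exact: measurable_pair2. Qed.

Let if_ : (P \x Q)%E.-integrable setT (EFin \o f).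
Proof. exact: (@bm_integrable _ _ _ (P \x Q)%E). Qed.

Lemma bm_mean_snd : bounded_measurable (fun x => mean Q (fun y => f (x, y))).
Proof.
split; first by apply: measurableT_comp => //; exact: (measurable_fubini_F if_).
have [_ [M fM]] := bf; exists M => x; apply: norm_mean_le => //.
exact: bm_pair1.
Qed.

Lemma bm_mean_fst : bounded_measurable (fun y => mean P (fun x => f (x, y))).
Proof.
split; first by apply: measurableT_comp => //; exact: (measurable_fubini_G if_).
have [_ [M fM]] := bf; exists M => x; apply: norm_mean_le => //.
exact: bm_pair2.
Qed.

Lemma mean_prod : mean (P \x Q)%E f = mean P (fun x => mean Q (fun y => f (x, y))).
Proof.
rewrite [LHS]/mean [LHS]/Rintegral -(integral12_prod_meas1 if_).
congr fine; apply: eq_integral => x _; rewrite /mean /Rintegral fineK//.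
exact: (integrable_fin_num _ (bm_integrable Q (bm_pair1 x))).
Qed.

Lemma mean_prodC : mean (P \x Q)%E f = mean Q (fun y => mean P (fun x => f (x, y))).
Proof.
rewrite [LHS]/mean [LHS]/Rintegral -(integral21_prod_meas1 if_).
congr fine; apply: eq_integral => x _; rewrite /mean /Rintegral fineK//.
exact: (integrable_fin_num _ (bm_integrable P (bm_pair2 x))).
Qed.

End product.

Lemma mean_distribution {R : realType} {d d' : measure_display}
    {T : measurableType d} {T' : measurableType d'} (P : probability T R)
    (X : {RV P >-> T'}) (f : T' -> R) : bounded_measurable f ->
  mean (distribution P X) f = mean P (fun x => f (X x)).
Proof.
move=> bf; rewrite /mean /Rintegral integral_distribution//.
  by case: bf => mf _; exact/measurable_EFinP.
exact: (bm_integrable P (bm_comp _ bf)).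
Qed.

(** * The n-fold product law *)

Section product_tuple.
Context {R : realType} {d : measure_display} {S : measurableType d}.
Variable P : probability S R.

Definition cons_pair n (x : S * n.-tuple S) : n.+1.-tuple S :=
  [the n.+1.-tuple S of x.1 :: x.2].

Lemma measurable_cons_pair n : measurable_fun [set: S * n.-tuple S] (@cons_pair n).
Proof. exact: measurable_cons. Qed.

HB.instance Definition _ n :=
  @isMeasurableFun.Build _ _ (S * n.-tuple S)%type (n.+1.-tuple S)
    (@cons_pair n) (@measurable_cons_pair n).

(** The recursion splits off the first observation, so that induction on [n] always meets a binary
    product, to which Fubini's theorem applies. *)
Fixpoint product_tuple n : probability (n.-tuple S) R :=
  match n with
  | 0 => \d_([tuple] : 0.-tuple S)
  | n'.+1 => distribution (P \x product_tuple n')%E (@cons_pair n')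
  end.

Lemma bm_cons_pair n (f : n.+1.-tuple S -> R) : bounded_measurable f ->
  bounded_measurable (f \o @cons_pair n).
Proof. by move=> bf; apply: (bm_comp _ bf); exact: measurable_cons_pair. Qed.

Lemma mean_product_tuple0 (f : 0.-tuple S -> R) : bounded_measurable f ->
  mean (product_tuple 0) f = f [tuple].
Proof.
move=> [mf _]; rewrite /mean /Rintegral integral_dirac//=.
  by rewrite indicT mul1r.
exact/measurable_EFinP.
Qed.

Lemma mean_product_tupleS n (f : n.+1.-tuple S -> R) : bounded_measurable f ->
  mean (product_tuple n.+1) f = mean (P \x product_tuple n)%E (f \o @cons_pair n).
Proof. by move=> bf; rewrite mean_distribution. Qed.

End product_tuple.

(** * Tensorization of entropy *)

Section log_sum.
Context {R : realType}.

(* The tangent form of the joint convexity of (x, y) |-> x ln (x / y) at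
   (g, c): integrated, it yields the log-sum inequality. *)
Lemma log_sum_ineq (z z0 g c : R) : 0 < g -> 0 < c ->
  expR z * ln (g / c) + expR z - expR z0 * (g / c) <= expR z * (z - z0).
Proof.
move=> g0 c0; set w := z - z0 - ln (g / c).
have gc : 0 < g / c by rewrite divr_gt0.
have E : expR z0 * (g / c) = expR z * expR (- w).
  rewrite -expRD /w -[g / c in LHS](lnK (x := g / c)) ?posrE// -expRD.
  by congr expR; ring.
have := expR_ge1Dx (- w); rewrite E => H.
have := ler_wpM2l (expR_ge0 z) H; rewrite mulrDr /w; lra.
Qed.

(** This is [log_sum_ineq] at z = ln m and z0 = ln c, with its other two arguments equal to 1. *)
Lemma mul_ln_ge (m c : R) : 0 < m -> 0 < c -> m - c <= m * ln (m / c).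
Proof.
move=> m0 c0; have := @log_sum_ineq (ln m) (ln c) 1 1.
rewrite !ltr01 => /(_ isT isT).
by rewrite divr1 ln1 mulr0 add0r mulr1 !lnK ?posrE// ln_div.
Qed.

End log_sum.

Section tensorization.
Context {R : realType} {d : measure_display} {S : measurableType d}.
Variable P : probability S R.

(** The entropy of e^Z, not of [Z] itself. *)
Definition mentropy {d'} {T : measurableType d'} (Q : probability T R) (Z : T -> R) :=
  mean Q (fun x => Z x * expR (Z x))
  - mean Q (fun x => expR (Z x)) * ln (mean Q (fun x => expR (Z x))).

(** The Bregman divergence of x ln x between e^z and e^z0. *)
Definition entropy_gap (z z0 : R) := expR z0 - expR z + expR z * (z - z0).

Definition free_of_coord n (i : 'I_n) (Z : n.-tuple S -> R) :=
  forall x y : n.-tuple S, (forall j, j != i -> tnth x j = tnth y j) -> Z x = Z y.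

Lemma bm_entropy_gap {d'} {T : measurableType d'} (Z Z0 : T -> R) :
  bounded_measurable Z -> bounded_measurable Z0 ->
  bounded_measurable (fun x => entropy_gap (Z x) (Z0 x)).
Proof.
move=> bZ bZ0; apply: bmD.
  by apply: bmB; exact: bm_exp.
by apply: bmM; [exact: bm_exp|exact: bmB].
Qed.

Lemma bm_mean_mentropy {d'} {T : measurableType d'} (Q : probability T R)
    (Z : S * T -> R) : bounded_measurable Z ->
  bounded_measurable (fun s => mentropy Q (fun x => Z (s, x))).
Proof.
move=> bZ; have bE := bm_exp bZ; have [_ [M ZM]] := bZ.
apply: bmB; first exact: (bm_mean_snd P Q (bmM bZ bE)).
have bg := bm_mean_snd P Q bE; apply: (bmM bg); apply: (bm_ln _ _ bg).
  exact: (expR_gt0 (- M)).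
move=> s; rewrite -[leLHS](mean_cst Q); apply: le_mean => [||x].
- exact: bm_cst.
- exact: (bm_pair1 bE).
- by rewrite ler_expR; have := ZM (s, x); rewrite ler_norml => /andP[].
Qed.

(** By the chain rule, the entropy exceeds the mean conditional entropy by the entropy of the
    marginal [g]. The integral [c] of e^Z0 over the second factor is the same for every [s], so
    integrating [log_sum_ineq] bounds that marginal entropy by the mean gap. *)
Lemma mentropy_prod {d'} {T : measurableType d'} (Q : probability T R)
    (Z Z0 : S * T -> R) :
  bounded_measurable Z -> bounded_measurable Z0 ->
  (forall s s' x, Z0 (s, x) = Z0 (s', x)) ->
  mentropy (P \x Q)%E Z <=
  mean (P \x Q)%E (fun y => entropy_gap (Z y) (Z0 y))
  + mean P (fun s => mentropy Q (fun x => Z (s, x))).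
Proof.
move=> bZ bZ0 Z0E.
have bE := bm_exp bZ; have bE0 := bm_exp bZ0.
pose g s := mean Q (fun x => expR (Z (s, x))).
have bg : bounded_measurable g by exact: (bm_mean_snd P Q bE).
have [M ZM] : exists M, forall y, `|Z y| <= M by case: bZ.
have gM s : expR (- M) <= g s.
  rewrite -[leLHS](mean_cst Q); apply: le_mean => [||x].
  - exact: bm_cst.
  - exact: (bm_pair1 bE).
  - by rewrite ler_expR; have := ZM (s, x); rewrite ler_norml => /andP[].
have g0 s : 0 < g s by rewrite (lt_le_trans _ (gM s))// expR_gt0.
have bgln : bounded_measurable (fun s => g s * ln (g s)).
  by apply: bmM => //; apply: (bm_ln _ gM) => //; exact: expR_gt0.
pose m := mean (P \x Q)%E (fun y => expR (Z y)).
have mE : m = mean P g by exact: mean_prod.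
pose c := mean (P \x Q)%E (fun y => expR (Z0 y)).
have cE s : c = mean Q (fun x => expR (Z0 (s, x))).
  rewrite /c (mean_prod P Q bE0) -[RHS](mean_cst P).
  congr (mean P _); apply/funext => s'.
  by congr (mean Q _); apply/funext => x; rewrite (Z0E s s').
have c0 : 0 < c.
  have [_ [M' ZM']] := bZ0; apply: (@lt_le_trans _ _ (expR (- M'))).
    exact: expR_gt0.
  rewrite -[leLHS](mean_cst (P \x Q)%E); apply: le_mean => // [|y].
    exact: bm_cst.
  by rewrite ler_expR; have := ZM' y; rewrite ler_norml => /andP[].
have m0 : 0 < m.
  rewrite mE (@lt_le_trans _ _ (expR (- M))) ?expR_gt0//.
  by rewrite -[leLHS](mean_cst P); apply: le_mean => //; exact: bm_cst.
have -> : mentropy (P \x Q)%E Z = mean P (fun s => g s * ln (g s)) - m * ln m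
    + mean P (fun s => mentropy Q (fun x => Z (s, x))).
  rewrite /mentropy -/m (mean_prod P Q (bmM bZ bE)).
  rewrite (meanB P (bm_mean_snd P Q (bmM bZ bE)) bgln).
  by rewrite /g; lra.
rewrite lerD2r.
have bE1 s : bounded_measurable (fun x => expR (Z (s, x))) := bm_pair1 bE s.
have bE01 s : bounded_measurable (fun x => expR (Z0 (s, x))) := bm_pair1 bE0 s.
have bEZ s : bounded_measurable
    (fun x => expR (Z (s, x)) * (Z (s, x) - Z0 (s, x))).
  exact: (bmM (bE1 s) (bmB (bm_pair1 bZ s) (bm_pair1 bZ0 s))).
have gap s : g s * ln (g s) - g s * ln c - g s + c <=
    mean Q (fun x => entropy_gap (Z (s, x)) (Z0 (s, x))).
  have -> : mean Q (fun x => entropy_gap (Z (s, x)) (Z0 (s, x))) =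
      c - g s + mean Q (fun x => expR (Z (s, x)) * (Z (s, x) - Z0 (s, x))).
    rewrite (cE s) /g -(meanB Q (bE01 s) (bE1 s)).
    by rewrite -(meanD Q (bmB (bE01 s) (bE1 s)) (bEZ s)).
  (* The weight g s / c makes e^Z0 integrate to [g s], which cancels the integral of e^Z. *)
  have bl := bmZ (ln (g s / c)) (bE1 s).
  have br := bmZ (g s / c) (bE01 s).
  have := le_mean Q (bmB (bmD bl (bE1 s)) br) (bEZ s).
  rewrite (meanB Q (bmD bl (bE1 s)) br) (meanD Q bl (bE1 s)).
  rewrite (meanZ Q _ (bE1 s)) (meanZ Q _ (bE01 s)) -(cE s) -/(g s).
  rewrite mulfVK ?gt_eqF// ln_div ?posrE// => H.
  suff : (ln (g s) - ln c) * g s + g s - g s <= mean Q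
    (fun x => expR (Z (s, x)) * (Z (s, x) - Z0 (s, x))) by lra.
  apply: H => x; rewrite -ln_div ?posrE//.
  by rewrite mulrC [X in _ - X]mulrC; exact: log_sum_ineq.
rewrite (mean_prod P Q (bm_entropy_gap bZ bZ0)).
have bgc : bounded_measurable (fun s => ln c * g s) := bmZ (ln c) bg.
have bgap : bounded_measurable (fun s => g s * ln (g s) - ln c * g s - g s + c).
  exact: (bmD (bmB (bmB bgln bgc) bg) (bm_cst c)).
apply: le_trans
  (le_mean P bgap (bm_mean_snd P Q (bm_entropy_gap bZ bZ0)) _).
  rewrite (meanD P (bmB (bmB bgln bgc) bg) (bm_cst c)).
  rewrite (meanB P (bmB bgln bgc) bg) (meanB P bgln bgc) (meanZ P _ bg) mean_cst.
  rewrite -mE; have := mul_ln_ge m0 c0; rewrite ln_div ?posrE//; lra.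
by move=> s; rewrite [ln c * _]mulrC; exact: gap.
Qed.

Lemma tnth_cons_pairS n (s : S) (x : n.-tuple S) i :
  tnth (cons_pair (s, x)) (lift ord0 i) = tnth x i.
Proof. exact: tnthS. Qed.

(** Induction on the number of coordinates: [mentropy_prod] pays for the first one with [Zi ord0];
    once that coordinate is frozen, each remaining [Zi] is still free of its own coordinate. *)
Theorem entropy_tensorization n (Z : n.-tuple S -> R) (Zi : 'I_n -> n.-tuple S -> R) :
  bounded_measurable Z -> (forall i, bounded_measurable (Zi i)) ->
  (forall i, free_of_coord i (Zi i)) ->
  mentropy (product_tuple P n) Z <=
  \sum_(i < n) mean (product_tuple P n) (fun x => entropy_gap (Z x) (Zi i x)).
Proof.
elim: n Z Zi => [|n IH] Z Zi bZ bZi fZi.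
  rewrite big_ord0 /mentropy !mean_product_tuple0; [|exact: bm_exp|].
    by rewrite expRK; lra.
  by apply: bmM => //; exact: bm_exp.
rewrite big_ord_recl.
have -> : mentropy (product_tuple P n.+1) Z =
    mentropy (P \x product_tuple P n)%E (Z \o @cons_pair _ _ n).
  rewrite /mentropy !mean_product_tupleS//; try exact: bm_exp.
  by apply: bmM => //; exact: bm_exp.
rewrite mean_product_tupleS; last exact: bm_entropy_gap.
have bcZ := bm_cons_pair bZ.
have bcZi i := bm_cons_pair (bZi i).
apply: (le_trans (mentropy_prod (product_tuple P n) bcZ (bcZi ord0) _)).
  move=> s s' x; apply: (fZi ord0) => j.
  by case: (unliftP ord0 j) => [i|] ->; rewrite ?eqxx// !tnth_cons_pairS.
rewrite lerD2l.
pose gap i (y : S * n.-tuple S) :=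
  entropy_gap (Z (cons_pair y)) (Zi (lift ord0 i) (cons_pair y)).
have bgap i : bounded_measurable (gap i).
  exact: (bm_entropy_gap bcZ (bcZi (lift ord0 i))).
have -> : \sum_(i < n) mean (product_tuple P n.+1)
      (fun x => entropy_gap (Z x) (Zi (lift ord0 i) x)) =
    mean P (fun s => \sum_(i < n) mean (product_tuple P n) (fun x => gap i (s, x))).
  rewrite (mean_sum P _ (fun i => bm_mean_snd P _ (bgap i))).
  apply: eq_bigr => i _.
  rewrite (mean_product_tupleS P (bm_entropy_gap bZ (bZi (lift ord0 i)))).
  exact: (mean_prod P _ (bgap i)).
apply: le_mean.
- exact: (bm_mean_mentropy (product_tuple P n) bcZ).
- exact: (bm_sum _ (fun i => bm_mean_snd P _ (bgap i))).
- move=> s; apply: IH => [|i|i].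
  + exact: (bm_pair1 bcZ).
  + exact: (bm_pair1 (bcZi _)).
  + move=> x y xy; apply: (fZi (lift ord0 i)) => j.
    case: (unliftP ord0 j) => [k|] -> //; rewrite (inj_eq lift_inj).
    by rewrite !tnth_cons_pairS; exact: xy.
Qed.

Definition set_coord n (x : n.-tuple S) (i : 'I_n) (s : S) : n.-tuple S :=
  [tuple if j == i then s else tnth x j | j < n].

Lemma measurable_set_coord n (x : n.-tuple S) i :
  measurable_fun [set: S] (set_coord x i).
Proof.
apply/measurable_fun_tnthP => j; have [->|ji] := eqVneq j i.
  rewrite (_ : _ \o _ = id)//; apply/funext => s /=.
  by rewrite tnth_mktuple eqxx.
rewrite (_ : _ \o _ = cst (tnth x j))//; apply/funext => s /=.
by rewrite tnth_mktuple (negbTE ji).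
Qed.

Lemma set_coord_cons0 n (x : n.-tuple S) s s' :
  set_coord (cons_pair (s', x)) ord0 s = cons_pair (s, x).
Proof.
apply: eq_from_tnth => j; rewrite tnth_mktuple.
by case: (unliftP ord0 j) => [i|] ->; rewrite // !tnth_cons_pairS.
Qed.

Lemma set_coord_consS n (x : n.-tuple S) i s s' :
  set_coord (cons_pair (s', x)) (lift ord0 i) s = cons_pair (s', set_coord x i s).
Proof.
apply: eq_from_tnth => j; rewrite tnth_mktuple.
case: (unliftP ord0 j) => [k|] -> //.
by rewrite (inj_eq lift_inj) !tnth_cons_pairS tnth_mktuple.
Qed.

(** Fubini's theorem with coordinate [i] integrated innermost: it suffices to compare the
    conditional means given the other coordinates. *)
Lemma le_mean_coord n (i : 'I_n) (G H : n.-tuple S -> R) :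
  bounded_measurable G -> bounded_measurable H ->
  (forall x, mean P (fun s => G (set_coord x i s)) <=
             mean P (fun s => H (set_coord x i s))) ->
  mean (product_tuple P n) G <= mean (product_tuple P n) H.
Proof.
elim: n i G H => [[]//|n IH] i G H bG bH GH.
rewrite !mean_product_tupleS//.
have bcG := bm_cons_pair bG; have bcH := bm_cons_pair bH.
case: (unliftP ord0 i) => [k|] ik; rewrite {}ik in GH.
  rewrite (mean_prod P _ bcG) (mean_prod P _ bcH).
  apply: le_mean => [||s];
    [exact: (bm_mean_snd P _ bcG)|exact: (bm_mean_snd P _ bcH)|].
  apply: (IH k) => [||x]; [exact: (bm_pair1 bcG)|exact: (bm_pair1 bcH)|].
  have := GH (cons_pair (s, x)).
  by under eq_fun do rewrite set_coord_consS;
     under [X in _ <= mean _ X]eq_fun do rewrite set_coord_consS.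
rewrite (mean_prodC P _ bcG) (mean_prodC P _ bcH).
apply: le_mean => [||x]; [exact: (bm_mean_fst P (product_tuple P n) bcG)
  |exact: (bm_mean_fst P (product_tuple P n) bcH)|].
(* [GH] speaks of a full tuple, whose head is then overwritten; reading both sides as constants
   integrated over [P] supplies such a head. *)
rewrite -[leLHS](mean_cst P) -[leRHS](mean_cst P).
apply: le_mean => [||s]; [exact: bm_cst|exact: bm_cst|].
have := GH (cons_pair (s, x)).
by under eq_fun do rewrite set_coord_cons0;
   under [X in _ <= mean _ X]eq_fun do rewrite set_coord_cons0.
Qed.

End tensorization.

(** * The differential inequality for the Laplace transform *)

Section real_analysis.
Context {R : realType}.

Lemma le_of_is_derive (f df : R -> R) (a b : R) : a <= b ->
  (forall x, x \in `[a, b] -> is_derive x 1 f (df x)) ->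
  (forall x, x \in `[a, b] -> 0 <= df x) -> f a <= f b.
Proof.
move=> ab fdf df0.
have dI x : x \in `]a, b[ -> is_derive x 1 f (df x).
  by move=> /subset_itv_oo_cc; exact: fdf.
have cI : {within `[a, b], continuous f}.
  by apply: derivable_within_continuous => x xab; have [] := fdf x xab.
have [c cab E] := MVT_segment ab dI cI.
by rewrite -subr_ge0 E mulr_ge0 ?subr_ge0// df0.
Qed.

(** The difference of the two sides vanishes at 0 and has derivative w (1 - e^-w). It serves for
    negative increments in [exp_gap_le]. *)
Lemma exp_rem_neg (w : R) : 0 <= w -> 1 - w ^+ 2 / 2 <= expR (- w) * (1 + w).
Proof.
move=> w0.
pose f (x : R) := expR (- x) * (1 + x) + x ^+ 2 / 2.
suff : f 0 <= f w.
  by rewrite /f oppr0 expR0 expr2 !mul0r; lra.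
apply: (@le_of_is_derive _ (fun x => x * (1 - expR (- x)))) => //.
  move=> x _; rewrite /f; apply: is_derive_eq.
  rewrite /GRing.scale/=.
  by field.
move=> x; rewrite in_itv/= => /andP[x0 _].
by rewrite mulr_ge0// subr_ge0 -[leRHS]expR0 ler_expR oppr_le0.
Qed.

Lemma expR_ge_quadratic (u : R) : 0 <= u -> 1 + u + u ^+ 2 / 2 <= expR u.
Proof.
move=> u0; pose f (x : R) := expR x - x - x ^+ 2 / 2.
suff : f 0 <= f u by rewrite /f expR0 expr2 !mul0r; lra.
apply: (@le_of_is_derive _ (fun x => expR x - 1 - x)) => //.
  move=> x _; rewrite /f; apply: is_derive_eq; rewrite /GRing.scale/=.
  by field.
move=> x _; have := expR_ge1Dx x; lra.
Qed.

(* The right-hand side is linear in y up to the quadratic term: for y the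
   increment of a near-maximizer, which is centred, only its variance is left
   after integration. *)
Lemma exp_gap_le (l x y : R) : 0 <= l -> y <= x -> x <= 1 ->
  1 - expR (l * x) + l * x * expR (l * x) <=
  l ^+ 2 * (x * expR (l * x) - y) + l ^+ 2 / 2 * y ^+ 2.
Proof.
move=> l0 yx x1.
(* This is the right-hand side at y = x. As a function of y the right-hand side is nonincreasing up
   to 1, so lowering y from x only increases it. *)
apply: (@le_trans _ _ (l ^+ 2 * (x * (expR (l * x) - 1)) + (l * x) ^+ 2 / 2)).
  have [x0|x0] := leP 0 x.
    have u0 : 0 <= l * x by rewrite mulr_ge0.
    have : 1 + (l * x) + (l * x) ^+ 2 / 2 <= expR (l * x).
      exact: expR_ge_quadratic.
    have : (l * x) ^+ 2 <= l ^+ 2 * x.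
      by rewrite exprMn ler_wpM2l ?sqr_ge0// expr2 ler_piMr.
    set u := l * x in u0 *; set e := expR u => lx ue.
    have e1 : 1 <= e.
      by rewrite (le_trans _ ue)// -addrA lerDl addr_ge0// divr_ge0// sqr_ge0.
    have : u ^+ 2 * (e - 1) <= l ^+ 2 * x * (e - 1) by rewrite ler_wpM2r// subr_ge0.
    (* What remains is 1 + u^2 / 2 <= e (1 - u + u^2); the quadratic lower bound on [e] proves it
       with u^3 / 2 + u^4 / 2 to spare. *)
    have : (1 + u + u ^+ 2 / 2) * (1 - u + u ^+ 2) <= e * (1 - u + u ^+ 2).
      by rewrite ler_wpM2r//; nra.
    have : 0 <= u ^+ 3 by rewrite exprn_ge0.
    have : 0 <= u ^+ 4 by rewrite exprn_ge0.
    nra.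
  have u0 : 0 <= - (l * x) by rewrite -mulrN mulr_ge0// oppr_ge0 ltW.
  have := exp_rem_neg u0; rewrite opprK sqrrN.
  have : 0 <= l ^+ 2 * (x * (expR (l * x) - 1)).
    rewrite mulr_ge0 ?sqr_ge0// mulr_le0 ?(ltW x0)// subr_le0 -[leRHS]expR0 ler_expR.
    by rewrite -oppr_ge0.
  lra.
have : 0 <= l ^+ 2 * ((x - y) * (1 - (x + y) / 2)).
  by rewrite mulr_ge0 ?sqr_ge0// mulr_ge0 ?subr_ge0//; lra.
lra.
Qed.

(* The differential inequality says that ln (F y) (1 / y - 1) - v y / 2 is
   nonincreasing in y; its limit at 0 is E. *)
Lemma log_mgf_bound (F dF : R -> R) (v E : R) :
  F 0 = 1 -> dF 0 = E -> 0 <= v ->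
  (forall l : R, 0 <= l -> 1 <= F l) ->
  (forall l : R, is_derive l 1 F (dF l)) ->
  (forall l : R, 0 < l -> l < 1 ->
    l * dF l - F l * ln (F l) <= l ^+ 2 * dF l + l ^+ 2 / 2 * v * F l) ->
  forall l : R, 0 < l -> l < 1 -> ln (F l) <= (l * E + v * l ^+ 2 / 2) / (1 - l).
Proof.
move=> F0 dF0 v0 F1 dF_ ode l l0 l1.
suff H (e : R) : 0 < e -> ln (F l) * (l^-1 - 1) <= v * l / 2 + E + e.
  have {}H : ln (F l) * (l^-1 - 1) <= v * l / 2 + E by apply/ler_addgt0Pr.
  rewrite ler_pdivlMr ?subr_gt0//.
  have := ler_wpM2l (ltW l0) H.
  have -> : l * (ln (F l) * (l^-1 - 1)) = ln (F l) * (1 - l).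
    by field; rewrite gt_eqF.
  lra.
move=> e0.
(* Instead of taking a limit at 0, the monotonicity is used from a point x where the difference
   quotient of [F] is within e of its derivative; then ln F <= F - 1 applies at x. *)
have [x [x0 xl Fx]] : exists x : R, [/\ 0 < x, x <= l & (F x - 1) / x <= E + e].
  have [dF00 dFE] := dF_ 0.
  move: (dF00) => /cvg_ex[D]; move=> HD.
  have DE : D = E.
    by rewrite -dF0 -dFE; apply/esym/cvg_lim.
  move: HD => /cvgrPdist_lt /(_ _ e0); rewrite DE => -[del /= del0 Hdel].
  exists (Num.min l (del / 2)); split.
  - by rewrite lt_min l0 divr_gt0.
  - by rewrite ge_min lexx.
  set x := Num.min _ _.
  have x0 : 0 < x by rewrite lt_min l0 divr_gt0.
  have : ball 0 del x.
    rewrite /ball/= sub0r normrN gtr0_norm//.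
    by rewrite (@le_lt_trans _ _ (del / 2)) ?ge_min ?lexx ?orbT//; lra.
  move=> /Hdel /(_ (lt0r_neq0 x0)).
  rewrite addr0 F0 /GRing.scale/= mulr1 ltr_norml => /andP[H _].
  by rewrite mulrC; lra.
pose N y := v * y / 2 + ln (F y) * (1 - y^-1).
pose dN y := v / 2 + (dF y / F y * (1 - y^-1) + ln (F y) / y ^+ 2).
have : N x <= N l.
  apply: (@le_of_is_derive N dN) => // y; rewrite in_itv/= => /andP[xy yl].
    have y0 : 0 < y by exact: lt_le_trans xy.
    have Fy : 0 < F y by rewrite (lt_le_trans ltr01)// F1// ltW.
    have := dF_ y => dFy.
    have dln : is_derive y 1 (fun z => ln (F z)) (dF y / F y).
      apply: is_derive_eq; last exact: mulrC.
      exact: (is_derive1_comp (is_derive1_ln Fy)).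
    have dV : is_derive y 1 (fun z : R => z^-1) (- y ^- 2).
      apply: is_derive_eq (is_deriveV _ _) _; first by rewrite gt_eqF.
      by rewrite /GRing.scale/= mulr1.
    rewrite /N; apply: is_derive_eq.
    rewrite /dN /GRing.scale/=; field; rewrite ?gt_eqF//.
  have y0 : 0 < y by exact: lt_le_trans xy.
  have Fy : 0 < F y by rewrite (lt_le_trans ltr01)// F1// ltW.
  have := ode y y0 (le_lt_trans yl l1).
  have -> : dN y = (y ^+ 2 * F y)^-1 * (y ^+ 2 / 2 * v * F y
      + y ^+ 2 * dF y - (y * dF y - F y * ln (F y))).
    by rewrite /dN; field; rewrite !gt_eqF.
  move=> H; apply: mulr_ge0; last by lra.
  by rewrite invr_ge0 mulr_ge0 ?sqr_ge0// ltW.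
rewrite /N.
have Fx1 : 1 <= F x by rewrite F1// ltW.
have lnFx : ln (F x) / x <= (F x - 1) / x.
  rewrite ler_pM2r ?invr_gt0//.
  have := @le_ln1Dx _ (F x - 1); rewrite [1 + _]addrC subrK; apply; lra.
have lnFx0 : 0 <= ln (F x) by exact: ln_ge0.
have vx : 0 <= v * x by rewrite mulr_ge0// ltW.
lra.
Qed.

End real_analysis.

(** * The Laplace transform and Chernoff's bound *)

Section mgf.
Context {R : realType} {d : measure_display} {T : measurableType d}.
Variables (Q : probability T R) (Z : T -> R).
Hypothesis bZ : bounded_measurable Z.

Definition mgf (l : R) := mean Q (fun x => expR (l * Z x)).

Definition mgf' (l : R) := mean Q (fun x => Z x * expR (l * Z x)).

Lemma bm_mgf (l : R) : bounded_measurable (fun x => expR (l * Z x)).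
Proof. exact: (bm_exp (bmZ l bZ)). Qed.

Lemma is_derive_mgf (l : R) : is_derive l 1 mgf (mgf' l).
Proof.
have [mZ [M ZM]] := bZ.
have dE (x : R) y : is_derive x 1 (fun l => expR (l * Z y)) (Z y * expR (x * Z y)).
  have dl : is_derive x 1 (fun l : R => l * Z y) (Z y).
    apply: is_derive_eq; rewrite /GRing.scale/=; ring.
  by apply: is_derive_eq (is_derive1_comp (is_derive_expR _) dl) _; rewrite mulrC.
have pE (x : R) y : partial1of2 (fun l y => expR (l * Z y)) x y = Z y * expR (x * Z y).
  by rewrite partial1of2E; have [_ ->] := dE x y.
have lI : `]l - 1, l + 1[%classic l by rewrite /= in_itv/=; apply/andP; split; lra.
(* A constant dominating the l-derivative of the integrand over the unit neighbourhood of [l]. *)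
pose G (_ : T) := M * expR ((`|l| + 1) * M).
have M0 (y : T) : 0 <= M by exact: le_trans (normr_ge0 (Z y)) (ZM y).
have intf (x : R) : `]l - 1, l + 1[%classic x ->
    Q.-integrable setT (EFin \o (fun y => expR (x * Z y))).
  by move=> _; exact: (bm_integrable Q (bm_mgf x)).
have derf (x : R) y : `]l - 1, l + 1[%classic x -> [set: T] y ->
    derivable ((fun l y => expR (l * Z y)) ^~ y) x 1.
  by move=> _ _; have [] := dE x y.
have G0 y : 0 <= G y by rewrite mulr_ge0 ?expR_ge0// (M0 y).
have intG : Q.-integrable setT (EFin \o G) by exact: (bm_integrable Q (bm_cst _)).
have Gub (x : R) y : `]l - 1, l + 1[%classic x -> [set: T] y ->
    `|partial1of2 (fun l y => expR (l * Z y)) x y| <= G y.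
  rewrite /= in_itv/= pE => /andP[lx xl] _; rewrite normrM.
  apply: ler_pM => //; rewrite ger0_norm ?expR_ge0// ler_expR.
  rewrite (le_trans (ler_norm _))// normrM ler_pM//.
  rewrite -[x in `|x|](subrK l) addrC (le_trans (ler_normD _ _))// lerD2l.
  by rewrite ler_distl !ltW.
apply: DeriveDef.
  exact: (derivable_under_integral measurableT lI intf derf G0 intG Gub).
rewrite -derive1E.
rewrite [LHS](differentiation_under_integral measurableT lI intf derf G0 intG Gub).
by congr (mean Q _); apply/funext => y; rewrite pE.
Qed.

Lemma mgf0 : mgf 0 = 1.
Proof.
rewrite /mgf -[RHS](mean_cst Q); congr (mean Q _).
by apply/funext => x; rewrite mul0r expR0.
Qed.

Lemma mgf'0 : mgf' 0 = mean Q Z.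
Proof.
rewrite /mgf'; congr (mean Q _).
by apply/funext => x; rewrite mul0r expR0 mulr1.
Qed.

Lemma mgf_ge1 (l : R) : 0 <= mean Q Z -> 0 <= l -> 1 <= mgf l.
Proof.
move=> Z0 l0; apply: (@le_trans _ _ (mean Q (fun x => 1 + l * Z x))).
  rewrite (meanD Q (bm_cst 1) (bmZ l bZ)) mean_cst (meanZ Q _ bZ).
  by rewrite lerDl mulr_ge0.
apply: le_mean; [exact: (bmD (bm_cst 1) (bmZ l bZ))|exact: bm_mgf|].
by move=> x; exact: expR_ge1Dx.
Qed.

Lemma chernoff_mgf (l s : R) : 0 < l ->
  (Q [set x | (s <= Z x)%R] <= (expR (- (l * s)) * mgf l)%:E)%E.
Proof.
move=> l0; have [mZ _] := bZ.
have mA : measurable [set x | s <= Z x].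
  rewrite (_ : [set x | _] = Z @^-1` `[s, +oo[%classic).
    by rewrite -[X in measurable X]setTI; exact: mZ.
  by apply/seteqP; split => x /=; rewrite in_itv/= andbT.
rewrite -[X in (Q X <= _)%E]setIT -integral_indic//.
have bI : bounded_measurable (\1_[set x | s <= Z x] : T -> R).
  split; first exact: measurable_indic.
  by exists 1 => x; rewrite indicE; case: (_ \in _); rewrite ?normr1 ?normr0.
have H : (mean Q \1_[set x | s <= Z x] <= expR (- (l * s)) * mgf l)%R.
  rewrite /mgf -(meanZ Q _ (bm_mgf l)).
  apply: le_mean => //; first exact: (bmZ _ (bm_mgf l)).
  move=> x; rewrite indicE; case: (boolP (x \in _)) => [|_].
    rewrite inE/= => sZ; rewrite -expRD -expR0 ler_expR.
    by rewrite addrC -mulrBr mulr_ge0 ?(ltW l0)// subr_ge0.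
  by rewrite mulr_ge0 ?expR_ge0.
apply: le_trans (_ : ((mean Q \1_[set x | (s <= Z x)%R])%:E <= _)%E); last first.
  by rewrite lee_fin.
rewrite /mean /Rintegral fineK//.
exact: (integrable_fin_num _ (bm_integrable Q bI)).
Qed.

End mgf.

(** * Concentration by the entropy method *)

Section concentration.
Context {R : realType} {d : measure_display} {S : measurableType d}.
Variable P : probability S R.

(** [exp_gap_le] is integrated with x = u and y = h - e, where the centred [h] is the increment of a
    near-maximizer; then e tends to 0. *)
Lemma le_mean_exp_gap (u : S -> R) (l v : R) : 0 < l -> l < 1 ->
  bounded_measurable u -> (forall s, u s <= 1) ->
  (forall e : R, 0 < e -> exists h : S -> R,
     [/\ bounded_measurable h, mean P h = 0, mean P (fun s => h s ^+ 2) <= v,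
         forall s, h s <= 1 & forall s, h s - e <= u s]) ->
  mean P (fun s => 1 - expR (l * u s) + l * u s * expR (l * u s)) <=
  l ^+ 2 * mean P (fun s => u s * expR (l * u s))
  + l ^+ 2 / 2 * v * mean P (fun s => expR (l * u s)).
Proof.
move=> l0 l1 bu u1 uh.
have bE := bm_mgf bu l.
have buE := bmM bu bE.
have bT : bounded_measurable
    (fun s => 1 - expR (l * u s) + l * u s * expR (l * u s)).
  exact: (bmD (bmB (bm_cst 1) bE) (bmM (bmZ l bu) bE)).
have v0 : 0 <= v.
  have [h [_ _ hv _ _]] := uh 1 ltr01.
  by apply: le_trans hv; apply: mean_ge0 => s; exact: sqr_ge0.
(* Jensen's inequality: [u] dominates a centred function up to e. This allows the factor E e^(lu) to
   be inserted next to the variance at the end. *)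
have E1 : 1 <= mean P (fun s => expR (l * u s)).
  apply/ler_addgt0Pr => e e0; have [h [bh h0 _ _ hu]] := uh e e0.
  have bL : bounded_measurable (fun s => 1 + (l * h s - e)).
    exact: (bmD (bm_cst 1) (bmB (bmZ l bh) (bm_cst e))).
  have : mean P (fun s => 1 + (l * h s - e)) <= mean P (fun s => expR (l * u s)).
    apply: (le_mean P bL bE) => s; apply: le_trans (expR_ge1Dx _).
    have : l * (h s - e) <= l * u s by rewrite ler_wpM2l// ltW.
    have : l * e <= e by rewrite ler_piMl// ltW.
    lra.
  rewrite (meanD P (bm_cst 1) (bmB (bmZ l bh) (bm_cst e))) mean_cst.
  rewrite (meanB P (bmZ l bh) (bm_cst e)) mean_cst (meanZ P _ bh) h0; lra.
suff H : mean P (fun s => 1 - expR (l * u s) + l * u s * expR (l * u s)) <=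
  l ^+ 2 * mean P (fun s => u s * expR (l * u s)) + l ^+ 2 / 2 * v.
  apply: (le_trans H); rewrite lerD2l ler_peMr// mulr_ge0// divr_ge0//.
  exact: sqr_ge0.
apply/ler_addgt0Pr => e0 e00.
pose e := Num.min 1 (e0 / 2).
have e_gt0 : 0 < e by rewrite lt_min ltr01 divr_gt0.
have e_le1 : e <= 1 by rewrite ge_min lexx.
have e_le0 : e <= e0 / 2 by rewrite ge_min lexx orbT.
have [h [bh h0 hv h1 hu]] := uh e e_gt0.
have bh2 : bounded_measurable (fun s => h s ^+ 2) := bmM bh bh.
(* The constant left when y = h - e is expanded. The term linear in [h] integrates to 0, and [c] is
   below [e0] by the choice of [e]. *)
pose c := l ^+ 2 * e + l ^+ 2 / 2 * e ^+ 2.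
have bB : bounded_measurable (fun s => l ^+ 2 * (u s * expR (l * u s))
    + l ^+ 2 / 2 * h s ^+ 2 - (l ^+ 2 * (1 + e)) * h s + c).
  exact: (bmD (bmB (bmD (bmZ _ buE) (bmZ _ bh2)) (bmZ _ bh)) (bm_cst c)).
have : mean P (fun s => 1 - expR (l * u s) + l * u s * expR (l * u s)) <= 
   mean P (fun s => l ^+ 2 * (u s * expR (l * u s))
    + l ^+ 2 / 2 * h s ^+ 2 - (l ^+ 2 * (1 + e)) * h s + c).
  apply: (le_mean P bT bB) => s.
  apply: (le_trans (exp_gap_le (ltW l0) (hu s) (u1 s))).
  by rewrite /c; lra.
rewrite (meanD P (bmB (bmD (bmZ _ buE) (bmZ _ bh2)) (bmZ _ bh)) (bm_cst c)).
rewrite (meanB P (bmD (bmZ _ buE) (bmZ _ bh2)) (bmZ _ bh)).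
rewrite (meanD P (bmZ _ buE) (bmZ _ bh2)) mean_cst.
rewrite (meanZ P _ buE) (meanZ P _ bh2) (meanZ P _ bh) h0.
have l2 : l ^+ 2 <= 1 by rewrite expr_le1// ltW.
have l20 : 0 <= l ^+ 2 by exact: sqr_ge0.
have : l ^+ 2 / 2 * mean P (fun s => h s ^+ 2) <= l ^+ 2 / 2 * v.
  by rewrite ler_wpM2l// divr_ge0.
have : l ^+ 2 * e <= 1 * e by rewrite ler_wpM2r// ltW.
have : l ^+ 2 * e ^+ 2 <= 1 * e.
  by apply: ler_pM => //; [exact: sqr_ge0|rewrite expr2 ler_piMr// ltW].
rewrite /c; lra.
Qed.

Section tuple.
Variables (n : nat) (Z : n.-tuple S -> R) (Zi : 'I_n -> n.-tuple S -> R) (v : R).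
Hypothesis bZ : bounded_measurable Z.
Hypothesis bZi : forall i, bounded_measurable (Zi i).
Hypothesis fZi : forall i, free_of_coord i (Zi i).
Hypothesis ZZi1 : forall x i, Z x - Zi i x <= 1.
Hypothesis sumZZi : forall x, \sum_(i < n) (Z x - Zi i x) <= Z x.
Hypothesis ZZi_ge : forall x i (e : R), 0 < e -> exists h : S -> R,
  [/\ bounded_measurable h, mean P h = 0, mean P (fun s => h s ^+ 2) <= v,
      forall s, h s <= 1 & forall s, h s - e <= Z (set_coord x i s) - Zi i x].
Hypothesis v0 : 0 <= v.
Let Q := product_tuple P n.
Hypothesis Z0 : 0 <= mean Q Z.

(** Tensorization is applied to l Z, [le_mean_exp_gap] treats each coordinate with the others
    frozen, and [sumZZi] collapses the sum of the increments to [Z]. *)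
Lemma mgf_differential_ineq (l : R) : 0 < l -> l < 1 ->
  l * mgf' Q Z l - mgf Q Z l * ln (mgf Q Z l) <=
  l ^+ 2 * mgf' Q Z l + l ^+ 2 / 2 * (n%:R * v) * mgf Q Z l.
Proof.
move=> l0 l1.
have bE := bm_mgf bZ l; have bZE := bmM bZ bE.
have blZ := bmZ l bZ; have blZi i := bmZ l (bZi i).
have bd i := bmB bZ (bZi i).
have -> : l * mgf' Q Z l - mgf Q Z l * ln (mgf Q Z l) =
    mentropy Q (fun x => l * Z x).
  rewrite /mentropy /mgf'; congr (_ - _).
  by rewrite -(meanZ Q _ bZE); congr (mean Q _); apply/funext => x; rewrite mulrA.
have fl i : free_of_coord i (fun x => l * Zi i x).
  by move=> x y xy; rewrite (fZi xy).
apply: (le_trans (entropy_tensorization P blZ blZi fl)).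
pose H i x := l ^+ 2 * ((Z x - Zi i x) * expR (l * Z x))
  + l ^+ 2 / 2 * v * expR (l * Z x).
have bH i : bounded_measurable (H i).
  exact: (bmD (bmZ _ (bmM (bd i) bE)) (bmZ _ bE)).
apply: (@le_trans _ _ (\sum_(i < n) mean Q (H i))).
  apply: ler_sum => i _; apply: (le_mean_coord (i := i)) => //.
    exact: (bm_entropy_gap blZ (blZi i)).
  move=> x.
  have mc := measurable_set_coord x i.
  have Zic s : Zi i (set_coord x i s) = Zi i x.
    by apply: fZi => j ji; rewrite tnth_mktuple (negbTE ji).
  pose u s := Z (set_coord x i s) - Zi i x.
  have bu : bounded_measurable u := bmB (bm_comp mc bZ) (bm_cst (Zi i x)).
  have u1 s : u s <= 1 by rewrite /u -(Zic s).
  have bu' := bm_mgf bu l.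
  (* As [Zi i] ignores coordinate i, this factor is constant in s and comes out of both integrals,
     leaving the increment [u] alone. *)
  set c := expR (l * Zi i x).
  have EZ s' : expR (l * Z (set_coord x i s')) = c * expR (l * u s').
    by rewrite /c /u -expRD; congr expR; ring.
  have -> : (fun s' => entropy_gap (l * Z (set_coord x i s'))
        (l * Zi i (set_coord x i s'))) =
      (fun s' => c * (1 - expR (l * u s') + l * u s' * expR (l * u s'))).
    apply/funext => s'; rewrite /entropy_gap Zic EZ -/c /u; ring.
  have -> : (fun s' => H i (set_coord x i s')) =
      (fun s' => c * (l ^+ 2 * (u s' * expR (l * u s'))
         + l ^+ 2 / 2 * v * expR (l * u s'))).
    apply/funext => s'; rewrite /H Zic EZ /u; ring.
  rewrite (meanZ P _ (bmD (bmB (bm_cst 1) bu') (bmM (bmZ l bu) bu'))).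
  rewrite (meanZ P _ (bmD (bmZ _ (bmM bu bu')) (bmZ _ bu'))).
  rewrite (meanD P (bmZ _ (bmM bu bu')) (bmZ _ bu')).
  rewrite (meanZ P _ (bmM bu bu')) (meanZ P _ bu').
  apply: ler_wpM2l; first exact: expR_ge0.
  exact: (le_mean_exp_gap l0 l1 bu u1 (@ZZi_ge x i)).
rewrite -(mean_sum Q _ bH).
have bHs := bm_sum (index_enum 'I_n) bH.
have bU : bounded_measurable (fun x => l ^+ 2 * (Z x * expR (l * Z x))
   + l ^+ 2 / 2 * (n%:R * v) * expR (l * Z x)).
  exact: (bmD (bmZ _ bZE) (bmZ _ bE)).
rewrite /mgf' /mgf -(meanZ Q _ bZE) -(meanZ Q _ bE).
rewrite -(meanD Q (bmZ _ bZE) (bmZ _ bE)).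
apply: (le_mean Q bHs bU) => x.
rewrite /H big_split/= -mulr_sumr -mulr_suml sumr_const card_ord -mulr_natl.
apply: lerD; last by rewrite le_eqVlt; apply/orP; left; apply/eqP; ring.
by rewrite ler_wpM2l ?sqr_ge0// ler_wpM2r// expR_ge0.
Qed.

Theorem bousquet_concentration (t : R) : 0 < t ->
  (Q [set x | (2 * mean Q Z + 3 / 2 * Num.sqrt (n%:R * v * t) + 2 * t <= Z x)%R]
    <= (expR (- t))%:E)%E.
Proof.
move=> t0; set s := 2 * _ + _ + _; pose V := n%:R * v.
have V0 : 0 <= V by rewrite mulr_ge0.
have key (l : R) : 0 < l -> l < 1 ->
    t + (l * mean Q Z + V * l ^+ 2 / 2) / (1 - l) <= l * s ->
    (Q [set x | (s <= Z x)%R] <= (expR (- t))%:E)%E.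
  move=> l0 l1 H; apply: (le_trans (chernoff_mgf Q bZ s l0)).
  have F0 : 0 < mgf Q Z l by rewrite (lt_le_trans ltr01)// mgf_ge1// ltW.
  rewrite lee_fin -[mgf Q Z l](lnK (x := mgf Q Z l)) ?posrE// -expRD ler_expR.
  have := log_mgf_bound (mgf0 Q Z) (mgf'0 Q Z) V0 (fun l => @mgf_ge1 _ _ _ Q Z bZ l Z0)
    (is_derive_mgf Q bZ) mgf_differential_ineq l0 l1.
  move=> H2; rewrite -lerBrDl; apply: (le_trans H2); rewrite -/V; lra.
(* The factor 2 before the mean of [Z] absorbs 1 / (1 - l) as long as l <= 1/2. The choice l = a /
   (a + b), with a and b the roots of t and V, satisfies this when t < V; otherwise l = 1/2
   suffices. *)
have [Vt|tV] := leP V t.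
  apply: (key (1 / 2)); [lra|lra|].
  have : V <= Num.sqrt (V * t).
    by rewrite -[leLHS]ger0_norm// -sqrtr_sqr ler_wsqrtr// expr2 ler_wpM2l.
  have -> : (1 - 1 / 2)^-1 = 2 :> R by field.
  rewrite /s -/V; have := sqrtr_ge0 (V * t); lra.
pose a := Num.sqrt t; pose b := Num.sqrt V.
have a0 : 0 < a by rewrite sqrtr_gt0.
have ab : a < b by rewrite ltr_sqrt// (lt_trans t0).
have b0 : 0 < b by exact: lt_trans ab.
have ta : t = a ^+ 2 by rewrite sqr_sqrtr// ltW.
have Vb : V = b ^+ 2 by rewrite sqr_sqrtr.
apply: (key (a / (a + b))).
- by rewrite divr_gt0// addr_gt0.
- by rewrite ltr_pdivrMr ?mul1r ?ltrDl// addr_gt0.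
- have -> : s = 2 * mean Q Z + 3 / 2 * (a * b) + 2 * a ^+ 2.
    by rewrite /s -/V sqrtrM// -ta [b * a]mulrC.
  have := Z0; set z := mean Q Z => z0.
  rewrite ta Vb -subr_ge0.
  have -> : a / (a + b) * (2 * z + 3 / 2 * (a * b) + 2 * a ^+ 2) -
      (a ^+ 2 + (a / (a + b) * z + b ^+ 2 * (a / (a + b)) ^+ 2 / 2) /
         (1 - a / (a + b))) =
      (z * a * (b - a) / b + a ^+ 3) / (a + b).
    by field; rewrite !gt_eqF// ?addr_gt0//; lra.
  rewrite divr_ge0 ?addr_ge0 ?(ltW a0) ?(ltW b0)//.
    by rewrite divr_ge0 ?(ltW b0)// !mulr_ge0 ?(ltW a0)// subr_ge0 ltW.
  by rewrite exprn_ge0// ltW.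
Qed.

End tuple.
End concentration.

(** * Suprema of empirical processes *)

Section suprema.
Context {R : realType} {d : measure_display} {S : measurableType d}.
Variables (P : probability S R) (n : nat) (H : set (S -> R)) (b v : R).
Hypothesis b0 : 0 < b.
Hypothesis v0 : 0 <= v.
Hypothesis H0 : H !=set0.
Hypothesis Hm : forall h, H h -> measurable_fun [set: S] h.
Hypothesis Hb : forall h x, H h -> `|h x| <= b.
Hypothesis Hmean : forall h, H h -> mean P h = 0.
Hypothesis Hvar : forall h, H h -> mean P (fun x => h x ^+ 2) <= v.
Hypothesis HN : forall h, H h -> H (fun x => - h x).
Hypothesis Hclass : measurable_class n H.

(** The weights treat at once the rescaled supremum, its leave-one-out versions (one weight 0) and
    the supremum of empirical means (all weights 1/n). *)
Definition supsum (e : 'I_n -> R) (x : n.-tuple S) : \bar R :=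
  ereal_sup [set `|\sum_(i < n) e i * h (tnth x i)|%:E | h in H].

Let w e x := fine (supsum e x).

Lemma supsum_fin e x : supsum e x = (w e x)%:E.
Proof.
have [h Hh] := H0.
have lb : (`|\sum_(i < n) e i * h (tnth x i)|%:E <= supsum e x)%E.
  by apply: ereal_sup_ubound; exists h.
have ub : (supsum e x <= (\sum_(i < n) `|e i| * b)%:E)%E.
  apply: ge_ereal_sup => _ [g Hg <-]; rewrite lee_fin.
  apply: (le_trans (ler_norm_sum _ _ _)); apply: ler_sum => i _.
  by rewrite normrM ler_wpM2l// Hb.
rewrite /w fineK// fin_numElt (lt_le_trans _ lb) ?ltNyr//=.
by rewrite (le_lt_trans ub) ?ltry.
Qed.

Lemma supsum_ub e x h : H h -> `|\sum_(i < n) e i * h (tnth x i)| <= w e x.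
Proof.
by move=> Hh; rewrite -lee_fin -supsum_fin; apply: ereal_sup_ubound; exists h.
Qed.

Lemma supsum_lub e x (M : R) :
  (forall h, H h -> `|\sum_(i < n) e i * h (tnth x i)| <= M) -> w e x <= M.
Proof.
move=> HM; rewrite -lee_fin -supsum_fin; apply: ge_ereal_sup => _ [h Hh <-].
by rewrite lee_fin HM.
Qed.

Lemma supsum_approx e x (eps : R) : 0 < eps ->
  exists2 h, H h & w e x - eps <= \sum_(i < n) e i * h (tnth x i).
Proof.
move=> eps0; apply: contrapT => /forall2NP/= Hn.
suff : w e x <= w e x - eps by lra.
have {}Hn h : H h -> \sum_(i < n) e i * h (tnth x i) <= w e x - eps.
  by move=> Hh; have [//|/negP] := Hn h; rewrite -ltNge => /ltW.
apply: supsum_lub => h Hh; rewrite ler_norml Hn// andbT lerNl.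
have := Hn _ (HN Hh); congr (_ <= _).
by rewrite -sumrN; apply: eq_bigr => i _; rewrite mulrN.
Qed.

Lemma supsum_ge0 e x : 0 <= w e x.
Proof. by have [h Hh] := H0; apply: le_trans (supsum_ub e x Hh). Qed.

Lemma supsumZ (c : R) e x : 0 <= c -> w (fun i => c * e i) x = c * w e x.
Proof.
move=> c0; apply/eqP; rewrite eq_le; apply/andP; split.
  apply: supsum_lub => h Hh.
  under eq_bigr do rewrite -mulrA.
  by rewrite -mulr_sumr normrM ger0_norm// ler_wpM2l// supsum_ub.
have [->|cn0] := eqVneq c 0; first by rewrite mul0r supsum_ge0.
have {}c0 : 0 < c by rewrite lt_neqAle eq_sym cn0.
rewrite mulrC -ler_pdivlMr//; apply: supsum_lub => h Hh.
rewrite ler_pdivlMr// mulrC -[c in c * `|_|]gtr0_norm// -normrM mulr_sumr.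
under eq_bigr do rewrite mulrA.
exact: supsum_ub.
Qed.

Lemma bm_supsum e : bounded_measurable (w e).
Proof.
split; first by apply: measurableT_comp => //; exact: Hclass.
exists (\sum_(i < n) `|e i| * b) => x.
rewrite ger0_norm ?supsum_ge0//; apply: supsum_lub => h Hh.
apply: (le_trans (ler_norm_sum _ _ _)); apply: ler_sum => i _.
by rewrite normrM ler_wpM2l// Hb.
Qed.

Let e1 (i : 'I_n) := b^-1.
Let e' (i j : 'I_n) := if j == i then 0 else b^-1.

Let sum_e1 (h : S -> R) x i : \sum_(j < n) e1 j * h (tnth x j) =
  b^-1 * h (tnth x i) + \sum_(j < n) e' i j * h (tnth x j).
Proof.
rewrite (bigD1 i)//= [in RHS](bigD1 i)//= /e' eqxx mul0r add0r; congr (_ + _).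
by apply: eq_bigr => j /negbTE ->.
Qed.

Let bi0 : 0 <= b^-1. Proof. by rewrite invr_ge0 ltW. Qed.

Lemma supsum_concentration0 (t : R) : 0 < t ->
  (product_tuple P n [set x | (2 * mean (product_tuple P n) (w e1)
     + 3 / 2 * Num.sqrt (n%:R * (v / b ^+ 2) * t) + 2 * t <= w e1 x)%R]
    <= (expR (- t))%:E)%E.
Proof.
move=> t0; apply: (@bousquet_concentration _ _ _ P n (w e1) (fun i => w (e' i))).
- exact: bm_supsum.
- by move=> i; exact: bm_supsum.
- move=> i x y xy; rewrite /w; congr fine; congr ereal_sup.
  apply: eq_imagel => h Hh; congr (`|_|%:E); apply: eq_bigr => j _.
  rewrite /e'; case: eqVneq => [_|ji]; first by rewrite !mul0r.
  by rewrite xy.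
- move=> x i; rewrite lerBlDr; apply: supsum_lub => h Hh.
  rewrite (sum_e1 h x i) (le_trans (ler_normD _ _))// lerD ?supsum_ub//.
  by rewrite normrM ger0_norm// mulrC ler_pdivrMr// mul1r Hb.
- move=> x; apply/ler_addgt0Pr => eps eps0.
  (* The n errors must add up to at most eps; dividing by n + 1 also covers n = 0. *)
  have eps1 : 0 < eps / n.+1%:R by rewrite divr_gt0.
  have [h Hh he] := supsum_approx e1 x eps1.
  set T := \sum_(i < n) _ in he.
  have TZ : T <= w e1 x by rewrite (le_trans (ler_norm _))// supsum_ub.
  apply: (@le_trans _ _ (\sum_(i < n) (eps / n.+1%:R + b^-1 * h (tnth x i)))).
    apply: ler_sum => i _.
    have : \sum_(j < n) e' i j * h (tnth x j) <= w (e' i) x.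
      by rewrite (le_trans (ler_norm _))// supsum_ub.
    have E : T = _ := sum_e1 h x i.
    move=> H1; rewrite lerBlDr (@le_trans _ _ (eps / n.+1%:R + T))//.
      by rewrite -lerBlDl.
    by rewrite E addrA lerD2l.
  rewrite big_split/= sumr_const card_ord -/T addrC lerD//.
  rewrite -[_ *+ n]mulr_natl mulrCA ler_piMr ?(ltW eps0)//.
  by rewrite ler_pdivrMr// mul1r ler_nat.
(* A near-maximizer of the leave-one-out supremum does not depend on coordinate i, so it bounds the
   increment from below for every value s of that coordinate. *)
- move=> x i eps eps0; have [h Hh he] := supsum_approx (e' i) x eps0.
  have bh : bounded_measurable h by split; [exact: Hm|exists b => s; exact: Hb].
  exists (fun s => b^-1 * h s); split.
  + exact: bmZ.
  + by rewrite meanZ// Hmean// mulr0.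
  + under eq_fun do rewrite exprMn.
    rewrite (meanZ P _ (bmM bh bh)) mulrC exprVn ler_pM2r ?invr_gt0 ?exprn_gt0//.
    exact: Hvar.
  + move=> s; rewrite mulrC ler_pdivrMr// mul1r.
    exact: le_trans (ler_norm _) (Hb s Hh).
  + move=> s; rewrite lerBrDr.
    apply: (@le_trans _ _ (\sum_(j < n) e1 j * h (tnth (set_coord x i s) j))).
      rewrite (sum_e1 h _ i) tnth_mktuple eqxx.
      have -> : \sum_(j < n) e' i j * h (tnth (set_coord x i s) j) =
          \sum_(j < n) e' i j * h (tnth x j).
        apply: eq_bigr => j _; rewrite tnth_mktuple /e'.
        by case: eqVneq => // _; rewrite !mul0r.
      lra.
    by rewrite (le_trans (ler_norm _))// supsum_ub.
- by rewrite divr_ge0// sqr_ge0.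
- by apply: mean_ge0 => x; exact: supsum_ge0.
- by [].
Qed.

Let Y := w (fun=> n%:R^-1).

Theorem supsum_concentration (t : R) : (0 < n)%N -> 0 < t ->
  (product_tuple P n [set x | (2 * mean (product_tuple P n) Y
     + 3 / 2 * Num.sqrt (v * (t / n%:R)) + 2 * b * (t / n%:R) <= Y x)%R]
    <= (expR (- t))%:E)%E.
Proof.
move=> n0 t0; have := supsum_concentration0 t0.
have n0' : 0 < n%:R :> R by rewrite ltr0n.
have YE x : Y x = b / n%:R * w e1 x.
  rewrite /Y -supsumZ ?divr_ge0// ?(ltW b0)//.
  by congr (w _ x); apply/funext => i; rewrite /e1; field; rewrite !gt_eqF.
have -> : mean (product_tuple P n) Y = b / n%:R * mean (product_tuple P n) (w e1).
  rewrite -meanZ; last exact: bm_supsum.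
  by congr (mean _ _); apply/funext.
set m := mean _ _.
have -> : Num.sqrt (v * (t / n%:R)) =
    b / n%:R * Num.sqrt (n%:R * (v / b ^+ 2) * t).
  rewrite -[b / n%:R]ger0_norm ?divr_ge0// ?(ltW b0)//.
  rewrite -sqrtr_sqr -sqrtrM ?sqr_ge0//; congr Num.sqrt.
  by field; rewrite !gt_eqF.
congr (_ <= _)%E; congr (product_tuple P n _); apply/seteqP.
have bn : 0 < b / n%:R by rewrite divr_gt0.
have E : 2 * (b / n%:R * m) +
    3 / 2 * (b / n%:R * Num.sqrt (n%:R * (v / b ^+ 2) * t)) +
    2 * b * (t / n%:R) = b / n%:R *
    (2 * m + 3 / 2 * Num.sqrt (n%:R * (v / b ^+ 2) * t) + 2 * t) by ring.
by split => x /=; rewrite YE E ler_pM2l.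
Qed.

End suprema.

(** * Bernstein's inequality for one function *)

Section bernstein.
Context {R : realType} {d : measure_display} {S : measurableType d}.
Variables (P : probability S R) (n : nat) (h : S -> R) (v : R).
Hypothesis bh : bounded_measurable h.
Hypothesis h1 : forall s, h s <= 1.
Hypothesis h0 : mean P h = 0.
Hypothesis hv : mean P (fun s => h s ^+ 2) <= v.

(** A sum of a single centred function fits the concentration theorem exactly: each increment is [h]
    itself and the increments add up to [Z]. Its mean is 0, so the factor 2 before the mean costs
    nothing. *)
Theorem bernstein (t : R) : (0 < n)%N -> 0 < t ->
  (product_tuple P n [set x | (3 / 2 * Num.sqrt (v * (t / n%:R)) + 2 * (t / n%:R)
     <= n%:R^-1 * \sum_(i < n) h (tnth x i))%R] <= (expR (- t))%:E)%E.
Proof.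
move=> n0 t0.
have n0' : 0 < n%:R :> R by rewrite ltr0n.
have btn i : bounded_measurable (fun x : n.-tuple S => h (tnth x i)).
  exact: (bm_comp (measurable_tnth i) bh).
have bZ := bm_sum (index_enum 'I_n) btn.
have mtn i : mean (product_tuple P n) (fun x => h (tnth x i)) = 0.
  have E x : mean P (fun s => h (tnth (set_coord x i s) i)) = mean P (fun=> 0).
    rewrite mean_cst -h0; congr (mean P _); apply/funext => s.
    by rewrite tnth_mktuple eqxx.
  rewrite -[RHS](mean_cst (product_tuple P n)).
  apply/eqP; rewrite eq_le; apply/andP; split.
    by apply: (le_mean_coord (i := i)) => // [|x]; [exact: bm_cst|rewrite E].
  by apply: (le_mean_coord (i := i)) => // [|x]; [exact: bm_cst|rewrite E].
have mZ : mean (product_tuple P n) (fun x => \sum_(i < n) h (tnth x i)) = 0.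
  by rewrite (mean_sum _ _ btn) big1// => i _; exact: mtn.
have Zi x i : \sum_(j < n) h (tnth x j) - \sum_(j < n | j != i) h (tnth x j)
    = h (tnth x i).
  by rewrite (bigD1 i)//= addrK.
have bZi i : bounded_measurable
    (fun x : n.-tuple S => \sum_(j < n | j != i) h (tnth x j)).
  under eq_fun do rewrite big_mkcond.
  apply: bm_sum => j; case: (_ != _); [exact: btn|exact: bm_cst].
have v0 : 0 <= v by apply: le_trans hv; apply: mean_ge0 => s; exact: sqr_ge0.
have := @bousquet_concentration _ _ _ P n _ _ v bZ bZi _ _ _ _ v0 _ t t0.
rewrite mZ mulr0 add0r => Hc.
have {}Hc := Hc _ _ _ _ (lexx 0).
apply: le_trans (Hc _ _ _ _).
- rewrite le_eqVlt; apply/orP; left; apply/eqP.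
  congr (product_tuple P n _); apply/seteqP.
  have -> : Num.sqrt (v * (t / n%:R)) = n%:R^-1 * Num.sqrt (n%:R * v * t).
    have -> : v * (t / n%:R) = n%:R^-1 ^+ 2 * (n%:R * v * t).
      by field; rewrite gt_eqF.
    by rewrite sqrtrM ?sqr_ge0// sqrtr_sqr ger0_norm// invr_ge0 ltW.
  have E : 3 / 2 * (n%:R^-1 * Num.sqrt (n%:R * v * t)) + 2 * (t / n%:R) =
      n%:R^-1 * (3 / 2 * Num.sqrt (n%:R * v * t) + 2 * t) by ring.
  by split => x /=; rewrite E ler_pM2l ?invr_gt0.
- by move=> i x y xy; apply: eq_bigr => j ji; rewrite xy.
- by move=> x i; rewrite Zi.
- by move=> x; under eq_bigr do rewrite Zi.
- move=> x i e e0; exists h; split => // s.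
  rewrite (_ : \sum_(j < n | j != i) h (tnth x j) =
    \sum_(j < n | j != i) h (tnth (set_coord x i s) j)).
    by rewrite Zi tnth_mktuple eqxx lerBlDr lerDl ltW.
  by apply: eq_bigr => j ji; rewrite tnth_mktuple (negbTE ji).
Qed.

End bernstein.

(** * The law of the sample *)

Section law.
Context {R : realType} {d : measure_display} {S : measurableType d}.

Definition box n (A : 'I_n -> set S) : set (n.-tuple S) :=
  \bigcap_(i in [set: 'I_n]) [set x | A i (tnth x i)].

Lemma measurable_box n (A : 'I_n -> set S) : (forall i, measurable (A i)) ->
  measurable (box A).
Proof.
move=> mA; apply: fin_bigcap_measurable => [|i _]; first exact: finite_finset.
by rewrite -[X in measurable X]setTI; exact: measurable_tnth.
Qed.

(** The sigma-algebra on tuples is generated by conditions on single coordinates; boxes generate it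
    too and are stable under intersection, as uniqueness of measures requires. *)
Lemma measurable_tupleE n : (measurable : set (set (n.-tuple S))) =
  <<s [set box A | A in [set A : 'I_n -> set S | forall i, measurable (A i)]] >>.
Proof.
apply/seteqP; split; last first.
  apply: smallest_sub; first exact: sigma_algebra_measurable.
  by move=> _ [A mA <-]; exact: measurable_box.
apply: smallest_sub; first exact: smallest_sigma_algebra.
rewrite -bigcup_seq => _ [i _ [A mA <-]]; apply: sub_sigma_algebra.
exists (fun j => if j == i then A else setT); first by move=> j; case: ifP.
rewrite setTI; apply/seteqP; split => x.
  by move=> /(_ i I) /=; rewrite eqxx.
by move=> Ax j _ /=; case: eqVneq => // ->.
Qed.

Variable P : probability S R.

Lemma product_tuple_box n (A : 'I_n -> set S) : (forall i, measurable (A i)) ->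
  product_tuple P n (box A) = (\prod_(i < n) fine (P (A i)))%:E.
Proof.
elim: n A => [|n IH] A mA.
  by rewrite big_ord0 /= diracE mem_set//; case.
rewrite big_ord_recl.
have -> : product_tuple P n.+1 (box A) =
  (P \x product_tuple P n)%E (@cons_pair _ S n @^-1` box A) by [].
have -> : @cons_pair _ S n @^-1` box A = A ord0 `*` box (fun i => A (lift ord0 i)).
  apply/seteqP; split => -[s x].
    move=> /= H; split; first exact: (H ord0).
    by move=> i _ /=; have := H (lift ord0 i) I; rewrite /= tnth_cons_pairS.
  move=> /= [As H] i _ /=; case: (unliftP ord0 i) => [j|] -> //.
  by rewrite tnth_cons_pairS; exact: H.
rewrite [LHS]product_measure1E//; last exact: measurable_box.
rewrite [RHS]EFinM fineK ?fin_num_measure//; congr (_ * _)%E.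
by apply: IH => i; exact: mA.
Qed.

Context {d' : measure_display} {Omega : measurableType d'}.
Variables (Pr : probability Omega R) (n : nat) (X : 'I_n -> {RV Pr >-> S}).

Definition sample_tuple (w : Omega) : n.-tuple S := [tuple X i w | i < n].

Lemma measurable_sample_tuple : measurable_fun [set: Omega] sample_tuple.
Proof.
apply/measurable_fun_tnthP => i; rewrite (_ : _ \o _ = X i)//.
by apply/funext => w /=; rewrite tnth_mktuple.
Qed.

HB.instance Definition _ := @isMeasurableFun.Build _ _ Omega (n.-tuple S)
  sample_tuple measurable_sample_tuple.

(** Independence gives the product formula on boxes, and boxes determine the law. *)
Lemma law_sample_tuple (A : set (n.-tuple S)) : iid_sample P X ->
  measurable A -> Pr (sample_tuple @^-1` A) = product_tuple P n A.
Proof.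
move=> [Xlaw Xindep] mA.
apply: (@measure_unique _ _ _ _ (fun=> setT) (measurable_tupleE n) _ _ _
  (distribution Pr sample_tuple) (product_tuple P n)) => //.
- move=> _ _ [B mB <-] [C mC <-]; exists (fun i => B i `&` C i).
    by move=> i; exact: measurableI.
  apply/seteqP; split => x /=.
    by move=> H; split => i _; have [] := H i I.
  by move=> [H1 H2] i _; split; [exact: H1|exact: H2].
- move=> _; exists (fun=> setT) => //.
  by apply/seteqP; split.
- by apply/seteqP; split => // x _; exists 0%N.
- move=> _ [B mB <-]; apply: etrans (esym (product_tuple_box mB)).
  rewrite /= /distribution /pushforward.
  have -> : sample_tuple @^-1` box B = \bigcap_(i in [set: 'I_n]) X i @^-1` B i.
    by apply/seteqP; split => w /= H i _; have := H i I; rewrite /= tnth_mktuple.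
  rewrite Xindep//; congr EFin; apply: eq_bigr => i _; congr fine.
  exact: Xlaw.
- by move=> _; apply: (@le_lt_trans _ _ 1%E); [exact: probability_le1|exact: ltry].
Qed.

Lemma mean_sample_tuple (f : n.-tuple S -> R) : iid_sample P X ->
  bounded_measurable f ->
  mean Pr (fun w => f (sample_tuple w)) = mean (product_tuple P n) f.
Proof.
move=> iidX bf; rewrite -(mean_distribution sample_tuple bf).
rewrite /mean /Rintegral; congr fine; apply: eq_measure_integral => A mA _.
exact: law_sample_tuple.
Qed.

End law.

Lemma bm_Lfun2 {R : realType} {d : measure_display} {T : measurableType d}
    (P : probability T R) (f : T -> R) :
  bounded_measurable f -> f \in Lfun P 2%:E.
Proof.
move=> bf; have [mf _] := bf; rewrite inE; apply/andP; split; rewrite inE//=.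
rewrite /finite_norm unlock poweR_lty//.
under eq_integral => x _/= do rewrite powR_mulrn// -normrX ger0_norm ?sqr_ge0//.
exact: (integrable_lty _ (bm_integrable P (bmM bf bf))).
Qed.

Lemma bm_unit_range {R : realType} {d : measure_display} {T : measurableType d}
    (f : T -> R) :
  measurable_fun [set: T] f -> (forall x, 0 <= f x <= 1) -> bounded_measurable f.
Proof.
move=> mf f01; split => //; exists 1 => x.
by have /andP[f0 f1] := f01 x; rewrite ger0_norm.
Qed.

(** * Deviation events for the sample *)

Section deviation.
Context {R : realType} {d d' : measure_display}
  {S : measurableType d} {Omega : measurableType d'}.
Variables (P : probability S R) (Pr : probability Omega R) (n : nat).
Variable X : 'I_n -> {RV Pr >-> S}.
Hypothesis n0 : (0 < n)%N.
Hypothesis iidX : iid_sample P X.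

Let mean_unit (f : S -> R) : measurable_fun [set: S] f ->
  (forall x, 0 <= f x <= 1) -> 0 <= mean P f <= 1.
Proof.
move=> mf f01; rewrite mean_ge0/=; last by move=> x; have /andP[] := f01 x.
rewrite -[leRHS](mean_cst P); apply: le_mean; last by move=> x; have /andP[] := f01 x.
  exact: bm_unit_range.
exact: bm_cst.
Qed.

Lemma empE (f : S -> R) w :
  emp X f w = n%:R^-1 * \sum_(i < n) f (tnth (sample_tuple X w) i).
Proof. by congr (_ * _); apply: eq_bigr => i _; rewrite tnth_mktuple. Qed.

Lemma empB (f g : S -> R) w : emp X (fun x => f x - g x) w = emp X f w - emp X g w.
Proof. by rewrite /emp big_split/= sumrN mulrBr. Qed.

Lemma emp_cst (c : R) w : emp X (fun=> c) w = c.
Proof.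
by rewrite /emp sumr_const card_ord -[c *+ n]mulr_natl mulKf// pnatr_eq0 -lt0n//.
Qed.

Lemma mean_centred_sqr (f : S -> R) (c : R) : bounded_measurable f -> c = mean P f ->
  mean P (fun x => (f x - c) ^+ 2) = mean P (fun x => f x ^+ 2) - mean P f ^+ 2.
Proof.
move=> bf ->; set m := mean P f.
have -> : (fun x => (f x - m) ^+ 2) = (fun x => f x ^+ 2 - (2 * m * f x - m ^+ 2)).
  by apply/funext => x; ring.
rewrite (meanB P (bmM bf bf) (bmB (bmZ (2 * m) bf) (bm_cst (m ^+ 2)))).
by rewrite (meanB P (bmZ (2 * m) bf) (bm_cst _)) (meanZ P _ bf) mean_cst -/m; ring.
Qed.

(** For values in [0, 1], f^2 <= f bounds the variance by the mean. Both signs of the centred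
    function are needed, whence the factor 2. *)
Lemma bernstein_event (f : S -> R) (t : R) : 0 < t ->
  measurable_fun [set: S] f -> (forall x, 0 <= f x <= 1) ->
  exists B : set Omega, [/\ measurable B, (Pr B <= (2 * expR (- t))%:E)%E &
   forall w, ~ B w -> `|emp X f w - mean P f| <=
      3 / 2 * Num.sqrt (mean P f * (t / n%:R)) + 2 * (t / n%:R)].
Proof.
move=> t0 mf f01; have bf := bm_unit_range mf f01.
have /andP[m0 m1] := mean_unit mf f01.
set m := mean P f in m0 m1 *; set s := 3 / 2 * _ + _.
have ev (h : S -> R) : bounded_measurable h -> (forall s, h s <= 1) ->
    mean P h = 0 -> mean P (fun s => h s ^+ 2) <= m ->
    exists B : set Omega, [/\ measurable B, (Pr B <= (expR (- t))%:E)%E &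
      forall w, ~ B w -> emp X h w <= s].
  move=> bh h1 h0 hm.
  pose B := [set x : n.-tuple S | s <= n%:R^-1 * \sum_(i < n) h (tnth x i)].
  have mB : measurable B.
    have [mS _] : bounded_measurable
        (fun x : n.-tuple S => n%:R^-1 * \sum_(i < n) h (tnth x i)).
      by apply: bmZ; apply: bm_sum => i; exact: (bm_comp (measurable_tnth i) bh).
    rewrite (_ : B = (fun x : n.-tuple S => n%:R^-1 * \sum_(i < n) h (tnth x i))
        @^-1` `[s, +oo[%classic).
      by rewrite -[X in measurable X]setTI; exact: mS.
    by apply/seteqP; split => x /=; rewrite in_itv/= andbT.
  exists (sample_tuple X @^-1` B); split.
  - by rewrite -[X in measurable X]setTI; exact: measurable_sample_tuple.
  - by rewrite (law_sample_tuple iidX mB); exact: bernstein.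
  - by move=> w /= /negP; rewrite -ltNge empE => /ltW.
have vm : mean P (fun x => (f x - m) ^+ 2) <= m.
  rewrite (mean_centred_sqr bf erefl) -/m.
  have : mean P (fun x => f x ^+ 2) <= m.
    apply: le_mean => [||x]; [exact: (bmM bf bf)|by []|].
    by have /andP[f0 f1] := f01 x; rewrite expr2 ler_piMr.
  have := sqr_ge0 m; lra.
have [||||B1 [mB1 PB1 HB1]] := ev (fun x => f x - m).
- exact: (bmB bf (bm_cst m)).
- by move=> x; have /andP[f0 f1] := f01 x; lra.
- by rewrite (meanB P bf (bm_cst m)) mean_cst subrr.
- exact: vm.
have [||||B2 [mB2 PB2 HB2]] := ev (fun x => m - f x).
- exact: (bmB (bm_cst m) bf).
- by move=> x; have /andP[f0 f1] := f01 x; lra.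
- by rewrite (meanB P (bm_cst m) bf) mean_cst subrr.
- rewrite (_ : (fun x => _) = (fun x => (f x - m) ^+ 2))//.
  by apply/funext => x; ring.
exists (B1 `|` B2); split.
- exact: measurableU.
- rewrite (_ : 2 * expR (- t) = expR (- t) + expR (- t)); last by ring.
  by rewrite EFinD (le_trans (measureU2 _ _ _))// leeD.
- move=> w /not_orP[/HB1 + /HB2].
  rewrite !empB !emp_cst => H1 H2.
  by rewrite ler_norml; apply/andP; split; lra.
Qed.

Variable rho : (S -> R) -> (S -> R) -> R.
Hypothesis rhoP : dominates_variance P rho.
Variable G : set (S -> R).
Hypothesis GP : forall f, G f ->
  measurable_fun [set: S] f /\ forall x, 0 <= f x <= 1.
Hypothesis G0 : G !=set0.

Lemma min_risk_le f : G f -> min_risk P G <= mean P f.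
Proof.
move=> Gf; apply: ge_inf; last by exists f.
by exists 0 => _ [g /GP[mg g01] <-]; have /andP[] := mean_unit mg g01.
Qed.

Lemma min_risk_ge0 : 0 <= min_risk P G.
Proof.
apply: lb_le_inf; first by have [f Gf] := G0; exists (mean P f), f.
by move=> _ [g /GP[mg g01] <-]; have /andP[] := mean_unit mg g01.
Qed.

Lemma near_minimizer (e : R) : 0 < e -> exists2 f, G f & excess_risk P G f <= e.
Proof.
move=> e0.
have hi : has_inf [set mean P g | g in G].
  split; first by have [f Gf] := G0; exists (mean P f), f.
  by exists 0 => _ [g /GP[mg g01] <-]; have /andP[] := mean_unit mg g01.
have [_ [f Gf <-] fe] := inf_adherent e0 hi.
by exists f => //; rewrite /excess_risk lerBlDl ltW.
Qed.

Lemma Ubar_ge0 (t dlt : R) : 0 < dlt -> 0 < t ->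
  [/\ (0 <= phi P X G dlt)%E, (0 <= diam P rho G dlt)%E &
      (0 <= diam P rho G dlt * (Num.sqrt (t / n%:R))%:E)%E].
Proof.
move=> dlt0 t0.
have [f Gf fd] := near_minimizer dlt0.
have [mf f01] := GP Gf; have fL := bm_Lfun2 P (bm_unit_range mf f01).
have d0 : (0 <= diam P rho G dlt)%E.
  apply: ereal_sup_ge; exists (rho f f)%:E; first by exists (f, f).
  by have [] := rhoP fL fL; rewrite lee_fin.
split=> //; last by rewrite mule_ge0// lee_fin sqrtr_ge0.
apply: integral_ge0 => w _; apply: ereal_sup_ge.
by eexists; [by exists (f, f)|rewrite lee_fin].
Qed.

(** [supsum_concentration] for the centred differences over the slice, whose variances are at most
    the squared diameter because [rho] dominates the variance. *)
Lemma deviation_event (t dlt c : R) : 0 < t -> 0 < dlt ->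
  measurable_class n (centred_differences P (slice P G dlt)) ->
  (Ubar P X rho G t dlt <= c%:E)%E ->
  exists B : set Omega, [/\ measurable B, (Pr B <= (expR (- t))%:E)%E &
   forall w, ~ B w -> forall f g, slice P G dlt f -> slice P G dlt g ->
     `|(emp X f w - mean P f) - (emp X g w - mean P g)| <= 2 * c].
Proof.
move=> t0 dlt0 mH Uc.
have [phi0 d0 ds0] := Ubar_ge0 dlt0 t0.
have a0 : 0 < t / n%:R by rewrite divr_gt0 ?ltr0n.
set H := centred_differences _ _ in mH.
have sl f : slice P G dlt f -> bounded_measurable f.
  by move=> [/GP[mf f01] _]; exact: bm_unit_range.
have sl01 f : slice P G dlt f -> forall x, 0 <= f x <= 1.
  by move=> [/GP[_ ?] _].
have slm f : slice P G dlt f -> 0 <= mean P f <= 1.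
  by move=> [/GP[mf f01] _]; exact: mean_unit.
(* An infinite diameter, multiplied by a positive root, would make [Ubar] infinite against [Uc]. *)
have dfin : diam P rho G dlt \is a fin_num.
  rewrite ge0_fin_numE// ltey; apply/eqP => dE.
  move: Uc; rewrite /Ubar dE gt0_mulye; last by rewrite lte_fin sqrtr_gt0.
  rewrite addey; last by rewrite gt_eqF// (lt_le_trans _ phi0)// ltNy0.
  rewrite addye; last by [].
  by rewrite gt0_muley ?lte_fin//.
pose D := fine (diam P rho G dlt).
have DE : diam P rho G dlt = D%:E by rewrite /D fineK.
have D0 : 0 <= D by rewrite -lee_fin -DE.
have HE h : H h -> exists f g, [/\ slice P G dlt f, slice P G dlt g &
    h = (fun x => f x - g x - (mean P f - mean P g))].
  move=> [[f g] [/= sf sg] <-]; exists f, g; split => //.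
  by apply/funext => x; rewrite (meanB P (sl _ sf) (sl _ sg)).
have H0 : H !=set0.
  have [f Gf fd] := near_minimizer dlt0.
  by eexists; exists (f, f).
have Hm h : H h -> measurable_fun [set: S] h.
  move=> /HE[f [g [sf sg ->]]].
  by have [] := bmB (bmB (sl _ sf) (sl _ sg)) (bm_cst (mean P f - mean P g)).
have Hb h x : H h -> `|h x| <= 2.
  move=> /HE[f [g [sf sg ->]]]; rewrite ler_norml.
  have /andP[? ?] := sl01 _ sf x; have /andP[? ?] := sl01 _ sg x.
  have /andP[? ?] := slm _ sf; have /andP[? ?] := slm _ sg.
  by apply/andP; split; lra.
have Hmean h : H h -> mean P h = 0.
  move=> /HE[f [g [sf sg ->]]].
  rewrite (meanB P (bmB (sl _ sf) (sl _ sg)) (bm_cst _)) mean_cst.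
  by rewrite (meanB P (sl _ sf) (sl _ sg)) subrr.
have Hvar h : H h -> mean P (fun x => h x ^+ 2) <= D ^+ 2.
  move=> /HE[f [g [sf sg ->]]].
  have bfg := bmB (sl _ sf) (sl _ sg).
  rewrite (mean_centred_sqr bfg); last by rewrite (meanB P (sl _ sf) (sl _ sg)).
  have [r0 rP] := rhoP (bm_Lfun2 P (sl _ sf)) (bm_Lfun2 P (sl _ sg)).
  apply: (le_trans rP); rewrite ler_sqr ?nnegrE//.
  by rewrite -lee_fin -DE; apply: ereal_sup_ubound; exists (f, g).
have HN h : H h -> H (fun x => - h x).
  move=> [[f g] [/= sf sg] <-]; exists (g, f) => //=.
  apply/funext => x; rewrite (meanB P (sl _ sf) (sl _ sg)).
  by rewrite (meanB P (sl _ sg) (sl _ sf)); ring.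
pose Y x := fine (@supsum _ _ _ n H (fun=> n%:R^-1) x).
have YE x : @supsum _ _ _ n H (fun=> n%:R^-1) x = (Y x)%:E.
  exact: (@supsum_fin _ _ _ n H 2).
have bY : bounded_measurable Y by exact: (@bm_supsum _ _ _ n H 2).
have emph h w : emp X h w = \sum_(i < n) n%:R^-1 * h (tnth (sample_tuple X w) i).
  by rewrite empE mulr_sumr.
(* The supremum inside [phi] is the one over centred differences evaluated at the sample, so its
   expectation can be computed under the product law. *)
have phiE : phi P X G dlt = (mean (product_tuple P n) Y)%:E.
  rewrite -(mean_sample_tuple iidX bY) /mean /Rintegral fineK; last first.
    have bYs : bounded_measurable (fun w => Y (sample_tuple X w)).
      exact: (bm_comp (measurable_sample_tuple X) bY).
    exact: (integrable_fin_num _ (bm_integrable Pr bYs)).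
  apply: eq_integral => w _; rewrite -YE; congr ereal_sup.
  apply/seteqP; split => y [].
    move=> [f g] [/= sf sg] <-.
    exists (fun x => f x - g x - mean P (fun y => f y - g y)).
      by exists (f, g).
    have := emph (fun x => f x - g x - mean P (fun y => f y - g y)) w.
    by rewrite (empB (fun x => f x - g x)) emp_cst => ->.
  move=> h [[f g] [/= sf sg] <-] <-; exists (f, g) => //=.
  have := emph (fun x => f x - g x - mean P (fun y => f y - g y)) w.
  by rewrite (empB (fun x => f x - g x)) emp_cst => ->.
(* The last coefficient is twice the envelope 2 of the centred differences. *)
pose s := 2 * mean (product_tuple P n) Y + 3 / 2 * Num.sqrt (D ^+ 2 * (t / n%:R))
  + 2 * 2 * (t / n%:R).
pose B := [set x : n.-tuple S | s <= Y x].
have mB : measurable B.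
  have [mY _] := bY.
  rewrite (_ : B = Y @^-1` `[s, +oo[%classic).
    by rewrite -[X in measurable X]setTI; exact: mY.
  by apply/seteqP; split => x /=; rewrite in_itv/= andbT.
exists (sample_tuple X @^-1` B); split.
- by rewrite -[X in measurable X]setTI; exact: measurable_sample_tuple.
- rewrite (law_sample_tuple iidX mB).
  by apply: (@supsum_concentration _ _ _ P n H 2) => //; exact: sqr_ge0.
move=> w /= /negP; rewrite -ltNge => Ys f g sf sg.
have -> : emp X f w - mean P f - (emp X g w - mean P g) =
    emp X (fun x => f x - g x - mean P (fun y => f y - g y)) w.
  by rewrite !empB emp_cst (meanB P (sl _ sf) (sl _ sg)); ring.
rewrite emph; apply: (@le_trans _ _ (Y (sample_tuple X w))).
  rewrite -lee_fin -YE; apply: ereal_sup_ubound.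
  by eexists; [by exists (f, g)|].
apply: (le_trans (ltW Ys)).
have : 2 * (mean (product_tuple P n) Y + D * Num.sqrt (t / n%:R) + t / n%:R) <= c.
  by rewrite -lee_fin; move: Uc; rewrite /Ubar phiE DE -EFinM.
have : 0 <= D * Num.sqrt (t / n%:R) by rewrite mulr_ge0 ?sqrtr_ge0.
have : 0 <= mean (product_tuple P n) Y by rewrite -lee_fin -phiE.
rewrite /s [Num.sqrt (D ^+ 2 * _)]sqrtrM ?sqr_ge0// sqrtr_sqr ger0_norm//; lra.
Qed.

End deviation.

(** * Excess risk over a single class *)

Section arithmetic.
Context {R : realType}.

Lemma sqrt_leP (x z : R) : 0 <= z -> x <= z ^+ 2 -> Num.sqrt x <= z.
Proof. by move=> z0 xz; rewrite -[z]ger0_norm// -sqrtr_sqr ler_wsqrtr. Qed.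

(** The weight 1/3 is chosen so that 3/2 times the root, as in Bernstein's bound, costs only x /
    2. *)
Lemma sqrt_amgm (x a : R) : 0 <= x -> 0 <= a -> Num.sqrt (x * a) <= x / 3 + 3 / 4 * a.
Proof.
move=> x0 a0; apply: sqrt_leP; first by rewrite addr_ge0 ?divr_ge0 ?mulr_ge0.
by have := sqr_ge0 (x / 3 - 3 / 4 * a); nra.
Qed.

(* Here [a = t/n], [m] is the minimal risk, [r] and [pf] are the empirical and
   the true risk of the empirical minimizer, and [z] and [y] those of a fixed
   near-minimizer of the risk. *)
Lemma risk_upper (a m r y pf z D : R) :
  0 < a -> 0 <= r -> 0 <= y -> y <= m + a -> m <= pf -> 0 <= D ->
  `|z - y| <= 3 / 2 * Num.sqrt (y * a) + 2 * a ->
  `|(r - pf) - (z - y)| <= D ->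
  pf < r + 10 * (D + Num.sqrt (a * r) + a).
Proof.
move=> a0 r0 y0 ym mpf D0; rewrite !ler_norml => /andP[zy1 zy2] /andP[rz1 rz2].
have sy := sqrt_amgm y0 (ltW a0).
(* The comparison with the empirical minimizer gives z <= r + D + a, and half of y from the root is
   absorbed on the left. *)
have yr : y <= 2 * r + 2 * D + 9 * a.
  by lra.
have sr0 := sqrtr_ge0 (a * r); set sr := Num.sqrt (a * r) in sr0 *.
have sr2 : sr ^+ 2 = a * r by rewrite sqr_sqrtr// mulr_ge0// ltW.
have : Num.sqrt (y * a) <= 3 / 2 * sr + D + 4 * a.
  apply: sqrt_leP; first by rewrite !addr_ge0// mulr_ge0// ltW.
  have : y * a <= (2 * r + 2 * D + 9 * a) * a by rewrite ler_wpM2r// ltW.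
  have : 0 <= D * a by rewrite mulr_ge0// ltW.
  have : 0 <= sr * D by rewrite mulr_ge0.
  have : 0 <= sr * a by rewrite mulr_ge0// ltW.
  have : 0 <= a * a by rewrite mulr_ge0// ltW.
  have : 0 <= D * D by rewrite mulr_ge0.
  have : 0 <= a * r by rewrite mulr_ge0// ltW.
  rewrite (_ : (3 / 2 * sr + D + 4 * a) ^+ 2 = 9 / 4 * sr ^+ 2 + D * D +
    16 * (a * a) + 3 * (sr * D) + 12 * (sr * a) + 8 * (D * a)); last by field.
  rewrite sr2; lra.
(* Altogether pf <= r + 5/2 D + 9/4 sr + 8 a, strictly below the claimed bound as a > 0. *)
lra.
Qed.

(** The near-minimizer gives r <= z, and Bernstein's bound keeps z near y <= m + a. Replacing the
    root of a r by that of a m yields m + 10 D + 33/2 S + 79/2 a, with S the root of a m. *)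
Lemma risk_lower (a m r y z D D' : R) :
  0 < a -> 0 <= m -> y <= m + a -> 0 <= D -> D <= D' ->
  `|z - y| <= 3 / 2 * Num.sqrt (y * a) + 2 * a -> r <= z ->
  r + 10 * (D + Num.sqrt (a * r) + a) <= m + 50 * (D' + Num.sqrt (a * m) + a).
Proof.
move=> a0 m0 ym D0 DD'; rewrite !ler_norml => /andP[zy1 zy2] rlez.
have sm := sqrt_amgm m0 (ltW a0); rewrite mulrC in sm.
have sm0 := sqrtr_ge0 (a * m); set S := Num.sqrt (a * m) in sm sm0 *.
have sm2 : S ^+ 2 = a * m by rewrite sqr_sqrtr// mulr_ge0// ltW.
have Sa : 0 <= S * a by rewrite mulr_ge0// ltW.
have aa : 0 <= a * a by rewrite mulr_ge0// ltW.
have am : 0 <= a * m by rewrite mulr_ge0// ltW.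
have sy : Num.sqrt (y * a) <= S + a.
  apply: sqrt_leP; first by rewrite addr_ge0// ltW.
  have : y * a <= (m + a) * a by rewrite ler_wpM2r// ltW.
  by rewrite sqrrD sm2; lra.
have rm : r <= 3 / 2 * m + 45 / 8 * a by lra.
have : Num.sqrt (a * r) <= 3 / 2 * S + 5 / 2 * a.
  apply: sqrt_leP; first by rewrite addr_ge0// mulr_ge0// ltW.
  have : a * r <= a * (3 / 2 * m + 45 / 8 * a) by rewrite ler_wpM2l// ltW.
  rewrite (_ : (3 / 2 * S + 5 / 2 * a) ^+ 2 = 9 / 4 * S ^+ 2 + 15 / 2 * (S * a)
    + 25 / 4 * (a * a)); last by field.
  rewrite sm2; lra.
lra.
Qed.

End arithmetic.

(** * Geometric levels *)

Section levels.
Context {R : realType} (q : R).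
Hypothesis q1 : 1 < q.

Let q0 : 0 < q. Proof. exact: lt_trans q1. Qed.

Lemma levelE (j : nat) : level q j = (q ^+ j)^-1.
Proof. by rewrite /level -invr_expz. Qed.

Lemma level_gt0 j : 0 < level q j.
Proof. by rewrite exprz_gt0. Qed.

Lemma levelS (j : nat) : level q j.+1 = level q j / q.
Proof. by rewrite !levelE exprSr invfM. Qed.

(** An admissible radius lies below the level, so the level takes part in the supremum defining
    [flat] at that radius. *)
Lemma le_level (psi : R -> \bar R) (eps : R) j :
  (sharp q psi eps < (level q j)%:E)%E ->
  (psi (level q j) <= (eps * level q j)%:E)%E.
Proof.
move=> /ereal_inf_lt[_ [x [x0 xe] <-]]; rewrite lte_fin => xl.
rewrite EFinM -lee_pdivrMr ?level_gt0//.
apply: le_trans xe; apply: ereal_sup_ubound; exists j => //.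
exact: ltW.
Qed.

End levels.

(** * The good event of a single class *)

Section class_event.
Context {R : realType} {d d' : measure_display}
  {S : measurableType d} {Omega : measurableType d'}.
Variables (q : R) (P : probability S R) (Pr : probability Omega R) (n : nat).
Variable X : 'I_n -> {RV Pr >-> S}.
Variables (rho : (S -> R) -> (S -> R) -> R) (G : set (S -> R)) (t : R).
Variable fhat : Omega -> S -> R.
Hypothesis q1 : 1 < q.
Hypothesis n0 : (0 < n)%N.
Hypothesis iidX : iid_sample P X.
Hypothesis rhoP : dominates_variance P rho.
Hypothesis GP : forall f, G f ->
  measurable_fun [set: S] f /\ forall x, 0 <= f x <= 1.
Hypothesis G0 : G !=set0.
Hypothesis mG : forall dlt : R, 0 < dlt ->
  measurable_class n (centred_differences P (slice P G dlt)).
Hypothesis Gfhat : forall w, G (fhat w).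
Hypothesis fhat_min : forall w f, G f -> emp X (fhat w) w <= emp X f w.
Hypothesis t0 : 0 < t.

Let a := t / n%:R.
Let a0 : 0 < a. Proof. by rewrite divr_gt0// ltr0n. Qed.
Let q0 : 0 < q. Proof. exact: lt_trans q1. Qed.
Let db := delta_bar P X q rho G t.

Let mean01 f : G f -> 0 <= mean P f <= 1.
Proof.
move=> /GP[mf f01]; rewrite mean_ge0/=; last by move=> x; have /andP[] := f01 x.
rewrite -[leRHS](mean_cst P); apply: le_mean; last by move=> x; have /andP[] := f01 x.
  exact: bm_unit_range.
exact: bm_cst.
Qed.

Let emp01 f w : G f -> 0 <= emp X f w <= 1.
Proof.
move=> /GP[mf f01]; rewrite /emp; apply/andP; split.
  by rewrite mulr_ge0 ?invr_ge0// sumr_ge0// => i _; have /andP[] := f01 (X i w).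
rewrite ler_pdivrMl ?ltr0n// mulr1.
rewrite -[leRHS](_ : \sum_(i < n) 1 = n%:R :> R); last first.
  by rewrite sumr_const card_ord.
by apply: ler_sum => i _; have /andP[] := f01 (X i w).
Qed.

Lemma min_emp_riskE w : min_emp_risk X G w = emp X (fhat w) w.
Proof.
apply/eqP; rewrite eq_le; apply/andP; split.
  apply: ge_inf; last by exists (fhat w).
  by exists 0 => _ [g Gg <-]; have /andP[] := emp01 w Gg.
apply: lb_le_inf; first by exists (emp X (fhat w) w), (fhat w).
by move=> _ [g Gg <-]; exact: fhat_min.
Qed.

(** [D] and [D'] stand for the values of the data-dependent and of the deterministic radius. *)
Let good_outcome (w : Omega) (D D' : R) :=
  mean P (fhat w) < emp X (fhat w) w + penalty 10 n t D (min_emp_risk X G w) /\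
  emp X (fhat w) w + penalty 10 n t D (min_emp_risk X G w) <=
  min_risk P G + penalty 50 n t D' (min_risk P G).

(** Risks lie in [0, 1], so a penalty with radius at least 1 outweighs any difference of risks. *)
Lemma class_event_trivial w (D D' : R) : 1 <= D -> D <= D' -> good_outcome w D D'.
Proof.
move=> D1 DD'; rewrite /good_outcome min_emp_riskE /penalty -/a.
have /andP[r0 r1] := emp01 w (Gfhat w); have /andP[m0 m1] := mean01 (Gfhat w).
set r := emp _ _ _ in r0 r1 *.
have k0 := min_risk_ge0 P GP G0; set m := min_risk P G in k0 *.
have a0' := a0.
have := sqrt_amgm r0 (ltW a0); rewrite [r * a]mulrC.
have := sqrtr_ge0 (a * r); have := sqrtr_ge0 (a * m).
set s := Num.sqrt (a * r); set s' := Num.sqrt (a * m) => s'0 s0 sE.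
by split; lra.
Qed.

(** [Ubar] is at least 2 a, while above [delta_bar] it is at most the level divided by 2 q^3. *)
Lemma level_ge (j : nat) : (db < (level q j)%:E)%E -> 4 * q ^+ 3 * a <= level q j.
Proof.
move=> /(le_level q1) U.
have [phi0 _ ds0] := Ubar_ge0 X rhoP GP G0 (level_gt0 q1 j) t0.
have : ((2 * a)%:E <= ((2 * q ^+ 3)^-1 * level q j)%:E)%E.
  apply: le_trans U; rewrite /Ubar EFinM lee_pmul2l ?lte_fin// leeDr//.
  exact: adde_ge0.
rewrite lee_fin ler_pdivlMl; last by rewrite mulr_gt0// exprn_gt0.
by apply: le_trans; rewrite le_eqVlt; apply/orP; left; apply/eqP; ring.
Qed.

(** The surplus 3 pays for the j + 1 levels from 0 to j and the two tails of Bernstein's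
    inequality. *)
Lemma level_count (j : nat) : (db < (level q j)%:E)%E ->
  j%:R + 3 <= logb q (q ^+ 3 * n%:R / t).
Proof.
move=> /level_ge; rewrite levelE// => H.
have lnq : 0 < ln q by rewrite ln_gt0.
rewrite /logb ler_pdivlMr//.
have -> : (j%:R + 3) * ln q = ln (q ^+ (j + 3)).
  by rewrite lnXn// -natrD mulr_natl.
have n0' : 0 < n%:R :> R by rewrite ltr0n.
rewrite ler_ln ?posrE ?exprn_gt0// ?divr_gt0 ?mulr_gt0 ?exprn_gt0//.
rewrite exprD [leLHS]mulrC -mulrA ler_pM2l ?exprn_gt0//.
have qj0 : 0 < q ^+ j by rewrite exprn_gt0.
rewrite -[leLHS]invrK -[leRHS]invrK lef_pV2 ?posrE ?invr_gt0 ?divr_gt0//.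
rewrite invf_div -/a; apply: le_trans H.
rewrite ler_peMl ?(ltW a0)//.
have : 1 <= q ^+ 3 by rewrite exprn_ege1// ltW.
lra.
Qed.

Lemma level_div (j : nat) : level q j / q ^+ 3 <= level q j.+1.
Proof.
rewrite levelS// ler_wpM2l ?(ltW (level_gt0 q1 _))//.
by rewrite lef_pV2 ?posrE ?exprn_gt0// -[leLHS]expr1 ler_weXn2l// ltW.
Qed.

(** Within a slice, the empirical minimizer beats a near-minimizer of the risk empirically, so its
    excess risk is at most the deviation; this puts it into the next slice. *)
Lemma localization w (J : nat) :
  (forall j, (j <= J)%N -> forall f g, slice P G (level q j) f ->
     slice P G (level q j) g ->
     `|(emp X f w - mean P f) - (emp X g w - mean P g)| <= level q j / q ^+ 3) ->
  slice P G (level q J) (fhat w) /\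
  excess_risk P G (fhat w) <= level q J / q ^+ 3.
Proof.
move=> Hdev.
have step j : (j <= J)%N -> slice P G (level q j) (fhat w) ->
    excess_risk P G (fhat w) <= level q j / q ^+ 3.
  move=> jJ sf; apply/ler_addgt0Pr => e e0.
  have e1 : 0 < Num.min e (level q j) by rewrite lt_min e0 level_gt0.
  have [g Gg] := near_minimizer P GP G0 e1.
  rewrite le_min => /andP[ge gl].
  have := Hdev j jJ _ _ sf (conj Gg gl); rewrite ler_norml => /andP[H _].
  have := fhat_min w Gg; move: ge; rewrite /excess_risk; lra.
have sl j : (j <= J)%N -> slice P G (level q j) (fhat w).
  elim: j => [_|j IH jJ]; split => //.
    (* Level 0 is 1, and that slice is the whole class. *)
    rewrite levelE// expr0 invr1 /excess_risk.
    have /andP[_ m1] := mean01 (Gfhat w).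
    have := min_risk_ge0 P GP G0; lra.
  exact: le_trans (step j (ltnW jJ) (IH (ltnW jJ))) (level_div j).
by split; [exact: sl|apply: step => //; exact: sl].
Qed.

Theorem class_event : exists B : set Omega, [/\ measurable B,
  (Pr B <= (Num.max 0 (logb q (q ^+ 3 * n%:R / t)) * expR (- t))%:E)%E &
  forall w, ~ B w -> forall D D' : R, (db <= D%:E)%E -> D <= D' ->
    good_outcome w D D'].
Proof.
(* If [db] is at least 1, so is [D], and the empty exceptional event will do. *)
have [db1|db1] := ltP db 1%E; last first.
  exists set0; split=> //.
    by rewrite measure0 lee_fin mulr_ge0 ?expR_ge0// le_max lexx.
  move=> w _ D D' dbD DD'; apply: class_event_trivial => //.
  by rewrite -lee_fin (le_trans db1).
pose Q j := `[< (db < (level q (Posz j))%:E)%E >].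
have Q0 : exists j, Q j.
  by exists 0%N; apply/asboolP; rewrite levelE// expr0 invr1.
have Qub j : Q j -> (j <= Num.bound (logb q (q ^+ 3 * n%:R / t)))%N.
  move=> /asboolP/level_count H.
  have L0 : 0 <= logb q (q ^+ 3 * n%:R / t) by rewrite (le_trans _ H)// addr_ge0.
  rewrite -(ler_nat R) ltW// (le_lt_trans _ (archi_boundP L0))//.
  by rewrite (le_trans _ H)// lerDl.
(* [J] is the last level above [db]; hence level J + 1 is at most [db]. *)
case: (ex_maxnP Q0 Qub) => J /asboolP QJ Jmax.
have Qle j : (j <= J)%N -> (db < (level q (Posz j))%:E)%E.
  move=> jJ; apply: (lt_le_trans QJ); rewrite lee_fin !levelE//.
  by rewrite lef_pV2 ?posrE ?exprn_gt0// ler_weXn2l// ltW.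
have dbJ : ((level q J.+1)%:E <= db)%E.
  by rewrite leNgt; apply/negP => /asboolP /Jmax; rewrite ltnn.
have /choice[B HB] : forall j : nat, exists B : set Omega,
    [/\ measurable B, (Pr B <= (expR (- t))%:E)%E &
     (j <= J)%N -> forall w, ~ B w -> forall f g, slice P G (level q j) f ->
     slice P G (level q j) g ->
     `|(emp X f w - mean P f) - (emp X g w - mean P g)| <= level q j / q ^+ 3].
  move=> j; have [jJ|Jj] := leqP j J; last first.
    by exists set0; split => //; rewrite measure0 lee_fin expR_ge0.
  have l0 := level_gt0 q1 j.
  have [B [mB PB HB]] := deviation_event n0 iidX rhoP GP G0 t0 l0 (mG l0)
    (le_level q1 (Qle j jJ)).
  exists B; split => // _ w Bw f g sf sg.
  apply: (le_trans (HB w Bw f g sf sg)).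
  rewrite le_eqVlt; apply/orP; left; apply/eqP.
  by field; rewrite gt_eqF.
have [f0 Gf0 f0a] := near_minimizer P GP G0 a0.
have [mf0 f01] := GP Gf0.
have [B0 [mB0 PB0 HB0]] := bernstein_event n0 iidX t0 mf0 f01.
pose BJ := \big[setU/set0]_(j < J.+1) B j.
have mBJ : measurable BJ by apply: bigsetU_measurable => j _; have [] := HB j.
exists (BJ `|` B0); split.
- exact: measurableU.
(* J + 1 deviation events and two Bernstein tails, each of probability at most e^-t. *)
- apply: (@le_trans _ _ ((J%:R + 3) * expR (- t))%:E); last first.
    rewrite lee_fin ler_wpM2r ?expR_ge0// le_max.
    by apply/orP; right; exact: level_count.
  apply: (le_trans (measureU2 _ mBJ mB0)).
  have -> : (J%:R + 3) * expR (- t) = \sum_(j < J.+1) expR (- t) + 2 * expR (- t).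
    by rewrite sumr_const card_ord -mulr_natl -natr1; ring.
  rewrite EFinD leeD// -sumEFin.
  apply: (@le_trans _ _ (\sum_(j < J.+1) Pr (B j))%E).
    apply: content_subadditive => // j _; by have [] := HB j.
  by apply: lee_sum => j _; have [] := HB j.
move=> w /not_orP[BJw /HB0 f0dev] D D' dbD DD'.
have Hdev j : (j <= J)%N -> forall f g, slice P G (level q j) f ->
     slice P G (level q j) g ->
     `|(emp X f w - mean P f) - (emp X g w - mean P g)| <= level q j / q ^+ 3.
  move=> jJ; have [_ _ H] := HB j; apply: (H jJ) => Bj; apply: BJw.
  have jJ' : (j < J.+1)%N by [].
  by rewrite /BJ -bigcup_seq; exists (Ordinal jJ') => //=; rewrite mem_index_enum.
have [sfhat efhat] := localization Hdev.
have lD : level q J / q ^+ 3 <= D.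
  by apply: (le_trans (level_div J)); rewrite -lee_fin (le_trans dbJ).
(* The excess risk a of [f0] is below level J by [level_ge], so the deviation bound compares [f0]
   with the empirical minimizer. *)
have sf0 : slice P G (level q J) f0.
  split=> //; apply: (le_trans f0a); apply: le_trans (level_ge QJ).
  rewrite ler_peMl ?(ltW a0)//.
  have : 1 <= q ^+ 3 by rewrite exprn_ege1// ltW.
  lra.
have D0 : 0 <= D.
  apply: le_trans lD; rewrite divr_ge0 ?exprn_ge0 ?(ltW q0)//.
  exact: ltW (level_gt0 q1 J).
have m0 := min_risk_ge0 P GP G0.
have /andP[r0 _] := emp01 w (Gfhat w).
have /andP[y0 _] := mean01 Gf0.
have ym : mean P f0 <= min_risk P G + a by rewrite -lerBlDl.
have mpf := min_risk_le P GP (Gfhat w).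
have rz := le_trans (Hdev J (leqnn J) _ _ sfhat sf0) lD.
have rlez := fhat_min w Gf0.
rewrite /good_outcome min_emp_riskE /penalty -/a; split.
  exact: (risk_upper a0 r0 y0 ym mpf D0 f0dev rz).
exact: (risk_lower a0 m0 ym D0 DD' f0dev rlez).
Qed.

End class_event.

(** * Union bound over the classes *)

Lemma mu_ext_le_series {R : realType} {d : measure_display}
    {T : measurableType d} (mu : {measure set T -> \bar R})
    (A : set T) (C : nat -> set T) (u : nat -> \bar R) (N : nat) :
  (forall k, (N <= k)%N -> measurable (C k)) ->
  (forall k, (N <= k)%N -> (mu (C k) <= u k)%E) ->
  (forall x, A x -> exists2 k, (N <= k)%N & C k x) ->
  ((mu^*)%mu A <= \sum_(N <= k <oo) u k)%E.
Proof.
move=> mC Cu AC.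
(* [A] may fail to be measurable, so it is covered by a measurable union; the empty sets below [N]
   make every term measurable. *)
pose F k := if (N <= k)%N then C k else set0.
have mF k : measurable (F k) by rewrite /F; case: ifPn => // Nk; exact: mC.
have mU : measurable (\bigcup_(k in ~` `I_N) F k).
  by apply: bigcup_measurable => k _.
apply: (@le_trans _ _ ((mu^*)%mu (\bigcup_(k in ~` `I_N) F k))).
  apply: le_mu_ext => x /AC[k Nk Ckx]; exists k; last by rewrite /F Nk.
  by rewrite /= ltnNge Nk.
rewrite measurable_mu_extE//.
apply: (@le_trans _ _ (\sum_(N <= k <oo) mu (F k))%E).
  exact: measure_sigma_subadditive_tail.
rewrite [leLHS]eseries_cond [leRHS]eseries_cond.
apply: lee_nneseries => [k _ _|k /= Nk]; first exact: measure_ge0.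
by rewrite /F Nk; exact: Cu.
Qed.

Theorem theorem5 (R : realType) :
  exists Khat Ktilde : R, [/\ 0 < Khat, 0 < Ktilde &
  forall (q : R) (d d' : measure_display)
    (S : measurableType d) (Omega : measurableType d')
    (P : probability S R) (Pr : probability Omega R)
    (n : nat) (X : 'I_n -> {RV Pr >-> S})
    (rho : (S -> R) -> (S -> R) -> R)
    (F : set (S -> R)) (Fk : nat -> set (S -> R))
    (fhat : nat -> Omega -> S -> R)
    (t p : nat -> R)
    (dhat : nat -> {RV Pr >-> R}) (dtilde : nat -> R)
    (khat : Omega -> nat),
  1 < q ->
  (0 < n)%N ->
  iid_sample P X ->
  dominates_variance P rho ->
  (forall f, F f ->
     measurable_fun [set: S] f /\ forall x, 0 <= f x <= 1) ->
  (forall k, (1 <= k)%N -> Fk k `<=` F) ->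
  (forall k (dlt : R), (1 <= k)%N -> 0 < dlt ->
     measurable_class n (centred_differences P (slice P (Fk k) dlt))) ->
  (forall k w, (1 <= k)%N ->
     Fk k (fhat k w) /\
     forall f, Fk k f -> emp X (fhat k w) w <= emp X f w) ->
  (forall k, (1 <= k)%N -> 0 < t k) ->
  (forall k, (1 <= k)%N ->
     ((1 - p k)%:E <=
      Pr [set w | (delta_bar P X q rho (Fk k) (t k) <= (dhat k w)%:E)%E /\
                  (dhat k w <= dtilde k)%R])%E) ->
  let pihat k w :=
    penalty Khat n (t k) (dhat k w) (min_emp_risk X (Fk k) w) in
  let pitilde k :=
    penalty Ktilde n (t k) (dtilde k) (min_risk P (Fk k)) in
  let objective k w := emp X (fhat k w) w + pihat k w in
  (forall w, (1 <= khat w)%N /\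
     forall k, (1 <= k)%N -> objective (khat w) w <= objective k w) ->
  let ffinal w := fhat (khat w) w in
  let bound :=
    (\sum_(1 <= k <oo) (failure_term q n (p k) (t k))%:E)%E in
  let bad_bound := [set w |
    inf [set objective k w | k in [set k | (1 <= k)%N]]
      <= mean P (ffinal w)] in
  let bad_oracle := [set w |
    inf [set min_risk P (Fk k) - min_risk P F + pitilde k
        | k in [set k | (1 <= k)%N]]
      <= excess_risk P F (ffinal w)] in
  ((Pr^*)%mu bad_bound <= bound)%E /\ ((Pr^*)%mu bad_oracle <= bound)%E].
Proof.
(* The constants of [risk_upper] and [risk_lower]. *)
exists 10, 50; split=> // q d d' S Omega P Pr n X rho F Fk fhat t p dhat dtilde
  khat q1 n0 iidX rhoP FP FkF mFk Hfhat t0 Hp pihat pitilde objective Hkhat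
  ffinal bound bad_bound bad_oracle.
have FkP k : (1 <= k)%N -> forall f, Fk k f ->
    measurable_fun [set: S] f /\ forall x, 0 <= f x <= 1.
  by move=> k1 f /(FkF k k1); exact: FP.
(* A point of the sample space yields a member of each class, namely its empirical minimizer
   there. *)
have [w0 _] : [set: Omega] !=set0.
  apply/set0P/eqP => O0.
  have := @probability_setT _ _ _ Pr.
  by rewrite O0 measure0 => /eqP; rewrite eqe eq_sym oner_eq0.
pose A k := [set w | (delta_bar P X q rho (Fk k) (t k) <= (dhat k w)%:E)%E /\
  (dhat k w <= dtilde k)%R].
have mA k : measurable (A k).
  rewrite (_ : A k = dhat k @^-1`
    ([set x | (delta_bar P X q rho (Fk k) (t k) <= x%:E)%E] `&`
      [set x | x <= dtilde k])); last by apply/seteqP; split.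
  rewrite -[X in measurable X]setTI; apply: measurable_funP => //.
  apply: measurableI.
    rewrite (_ : [set x | _] =
      EFin @^-1` `[delta_bar P X q rho (Fk k) (t k), +oo[%classic).
      rewrite -[X in measurable X]setTI; apply: EFin_measurable => //.
      exact: emeasurable_itv.
    by apply/seteqP; split => x /=; rewrite in_itv/= andbT.
  rewrite (_ : [set x | _] = `]-oo, dtilde k]%classic); first exact: measurable_itv.
  by apply/seteqP; split => x /=; rewrite in_itv/=.
have HC k : exists C : set Omega, (1 <= k)%N ->
   [/\ measurable C, (Pr C <= (failure_term q n (p k) (t k))%:E)%E &
    forall w, ~ C w -> mean P (fhat k w) < objective k w /\
      objective k w <= min_risk P (Fk k) + pitilde k].
  have [k1|] := boolP (1 <= k)%N; last by exists set0.
  have Gk0 : Fk k !=set0 by exists (fhat k w0); have [] := Hfhat k w0 k1.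
  have [B [mB PB HB]] := class_event q1 n0 iidX rhoP (FkP k k1) Gk0
    (fun dlt => mFk k dlt k1) (fun w => (Hfhat k w k1).1)
    (fun w => (Hfhat k w k1).2) (t0 k k1).
  (* Class k fails when its radii are out of order, with probability at most [p k], or on the
     exceptional event [B] of [class_event]. *)
  exists (~` A k `|` B) => _; split.
  - by apply: measurableU => //; exact: measurableC.
  - rewrite /failure_term EFinD.
    apply: (le_trans (measureU2 _ (measurableC (mA k)) mB)); apply: leeD => //.
    apply: (le_trans (_ : _ <= (1 - Pr (A k))%E)%E).
      by rewrite -(probability_setC Pr (mA k)).
    have fA : Pr (A k) \is a fin_num by exact: fin_num_measure.
    by have := Hp k k1; rewrite -/(A k) -(fineK fA) -EFinB !lee_fin; lra.
  - move=> w /not_orP[/contrapT[dA dA'] Bw].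
    by have [] := HB w Bw _ _ dA dA'.
have /choice[C {}HC] := HC.
have objective_inf w : inf [set objective k w | k in [set k | (1 <= k)%N]] =
    objective (khat w) w.
  have [kw kmin] := Hkhat w.
  apply/eqP; rewrite eq_le; apply/andP; split.
    apply: ge_inf; last by exists (khat w).
    by exists (objective (khat w) w) => _ [k k1 <-]; exact: kmin.
  apply: lb_le_inf; first by exists (objective (khat w) w), (khat w).
  by move=> _ [k k1 <-]; exact: kmin.
have good w : (forall k, (1 <= k)%N -> ~ C k w) ->
    mean P (ffinal w) < objective (khat w) w /\
    forall k, (1 <= k)%N -> objective (khat w) w <= min_risk P (Fk k) + pitilde k.
  move=> Cw; have [kw kmin] := Hkhat w; split.
    by have [_ _ H] := HC _ kw; have [] := H w (Cw _ kw).
  move=> k k1; apply: le_trans (kmin k k1) _.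
  by have [_ _ H] := HC _ k1; have [] := H w (Cw _ k1).
have bad_le (B : set Omega) :
    (forall w, B w -> ~ forall k, (1 <= k)%N -> ~ C k w) ->
    ((Pr^*)%mu B <= bound)%E.
  move=> HB; apply: (mu_ext_le_series (C := C)).
  - by move=> k /HC[].
  - by move=> k /HC[].
  - by move=> w /HB /existsNP[k /not_implyP[k1 /contrapT Cw]]; exists k.
split; apply: bad_le => w Bw /good[H1 H2].
  have : inf [set objective k w | k in [set k | (1 <= k)%N]] <=
    mean P (ffinal w) := Bw.
  by rewrite objective_inf leNgt H1.
have : inf [set min_risk P (Fk k) - min_risk P F + pitilde k
    | k in [set k | (1 <= k)%N]] <= excess_risk P F (ffinal w) := Bw.
apply/negP; rewrite -ltNge.
(* The selected objective strictly exceeds the true risk and is at most every oracle value, which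
   bounds it by their infimum. *)
apply: (@lt_le_trans _ _ (objective (khat w) w - min_risk P F)).
  by rewrite /excess_risk ltrD2r.
apply: lb_le_inf.
  by exists (min_risk P (Fk 1) - min_risk P F + pitilde 1), 1%N.
by move=> _ [k k1 <-]; rewrite [leRHS]addrAC lerD2r; exact: H2.
Qed.
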